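(* Let $\boldsymbol\alpha=(\alpha_1,\ldots,\alpha_n)$ and $\boldsymbol\beta=(\beta_1,\ldots,\beta_{n-1},1)$ be in $(\mathbb{Q}\cap(0,1])^n$ (put $\beta_n=1$), let $f(z)={}_nF_{n-1}(\boldsymbol\alpha,\boldsymbol\beta;z)$, and let $p$ be a prime number such that $p>2d_{\boldsymbol\alpha,\boldsymbol\beta}$ and $f(z)\in\mathbb{Z}_{(p)}[[z]]$. Suppose that $\alpha_i-\beta_j\notin\mathbb{Z}$ for all $i,j\in\{1,\ldots,n\}$. Then there is a nonzero polynomial $P_p(Y)\in\mathbb{F}_p(z)[Y]$ of degree at most $p^{2^n\varphi(d_{\boldsymbol\alpha,\boldsymbol\beta})}$ and of height at most $5^n(n+1)!\,p^{2^n\varphi(d_{\boldsymbol\alpha,\boldsymbol\beta})}$ such that $P_p(f(z)\bmod p)=0$, where $\varphi$ is Euler's totient function. Moreover, if $l$ is the order of $p$ in the unit group $(\mathbb{Z}/d_{\boldsymbol\alpha,\boldsymbol\beta}\mathbb{Z})^*$, and $S:=S_{\mathfrak{D}_p^{l-1}(\boldsymbol\alpha),\mathfrak{D}_p^{l-1}(\boldsymbol\beta),p}$, then the following hold: (1) if $\#S=1$ then $P_p(Y)=Y-Q_1(z)Y^{p^l}$, where $Q_1(z)\in\mathbb{F}_p[z]$ has degree less than $p^l$; (2) if $\#S=2$ then $P_p(Y)=Y-Q_1(z)Y^{p^l}-Q_2(z)Y^{p^{2l}}$ with $Q_1,Q_2\in\mathbb{F}_p(z)$, and the height of $P_p(Y)$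 is less than $2p^{2l}$; (3) if $\#S=t+1>2$ then $P_p(Y)=Y-Q_1(z)Y^{p^l}-Q_2(z)Y^{p^{2l}}-Q_3(z)Y^{p^{3l}}-\cdots-Q_{2^t}(z)Y^{p^{2^tl}}$ with $Q_1,\ldots,Q_{2^t}\in\mathbb{F}_p(z)$, and the height of $P_p(Y)$ is less than $5^t(t+1)!\,p^{2^tl}$.
   Context: Pochhammer symbol: $(x)_0=1$, $(x)_i=x(x+1)\cdots(x+i-1)$ for $i\ge1$. For $\boldsymbol\alpha=(\alpha_1,\ldots,\alpha_n)$, $\boldsymbol\beta=(\beta_1,\ldots,\beta_{n-1},1)$ with rational coordinates not in $\mathbb{Z}_{\le0}$, put $\mathcal{Q}_{\boldsymbol\alpha,\boldsymbol\beta}(i)=\frac{(\alpha_1)_i\cdots(\alpha_n)_i}{(\beta_1)_i\cdots(\beta_{n-1})_i\,i!}$ and ${}_nF_{n-1}(\boldsymbol\alpha,\boldsymbol\beta;z)=\sum_{i\ge0}\mathcal{Q}_{\boldsymbol\alpha,\boldsymbol\beta}(i)z^i$. $d_{\boldsymbol\alpha,\boldsymbol\beta}$ is the least common multiple of the denominators (in lowest form) of $\alpha_1,\ldots,\alpha_n,\beta_1,\ldots,\beta_{n-1}$. $\mathbb{Z}_{(p)}$ is the localization of $\mathbb{Z}$ at $(p)$, with residue field $\mathbb{F}_p$; $v_p$ is the $p$-adic valuation; $f\bmod p\in\mathbb{F}_p[[z]]$ is the coefficientwise reduction of $f\in\mathbb{Z}_{(p)}[[z]]$. Dwork map $\mathfrak{D}_p:\mathbb{Z}_{(p)}\to\mathbb{Z}_{(p)}$: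 $\mathfrak{D}_p(\gamma)$ is the unique element of $\mathbb{Z}_{(p)}$ with $p\mathfrak{D}_p(\gamma)-\gamma\in\{0,\ldots,p-1\}$. It acts coordinatewise on tuples; $\mathfrak{D}_p^m$ is its $m$-th iterate and $\mathfrak{D}_p^0$ the identity. Note $\mathfrak{D}_p(1)=1$. For $\boldsymbol\alpha=(\alpha_1,\ldots,\alpha_n)$, $\boldsymbol\beta=(\beta_1,\ldots,\beta_{n-1},1)$ in $(\mathbb{Z}_{(p)}\setminus\mathbb{Z}_{\le0})^n$, $E_{\boldsymbol\alpha,\boldsymbol\beta,p}$ is the set of $r\in\{0,\ldots,p-1\}$ such that $r\bmod p\in\{0,(1-\beta_1)\bmod p,\ldots,(1-\beta_{n-1})\bmod p\}$, and $S_{\boldsymbol\alpha,\boldsymbol\beta,p}=\{r\in E_{\boldsymbol\alpha,\boldsymbol\beta,p}: v_p(\mathcal{Q}_{\boldsymbol\alpha,\boldsymbol\beta}(r))=0\}$. Height: for a field $K$ and $a(z)=s(z)/t(z)\in K(z)$ in lowest form, the height of $a$ is $\max\{\deg s,\deg t\}$. For $P(Y)=\sum_{i=0}^m a_i(z)Y^i\in K(z)[Y]$ with $a_m\neq0$, the degree of $P$ is $m$ and the height of $P$ is the maximum of the heights of $a_0,\ldots,a_m$. *)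

(* Defs.v *)
From HB Require Import structures.
From mathcomp Require Import all_boot all_order all_algebra.
From mathcomp Require Import all_fingroup generic_quotient.
From mathcomp Require Import cyclic zify ring.
From mathcomp Require Import boolp classical_sets.

Set Implicit Arguments.
Unset Strict Implicit.
Unset Printing Implicit Defensive.

Import Order.TTheory GRing.Theory Num.Theory.
Local Open Scope ring_scope.

(* The library has no formal power series.  A record is used rather than the
   bare type nat -> R because the latter already carries the pointwise
   product. *)
Record fps (R : Type) := Fps { fcoef : nat -> R }.

Definition fps_map (A B : Type) (h : A -> B) (f : fps A) : fps B :=
  Fps (fun i => h (fcoef f i)).

HB.instance Definition _ (R : Type) := gen_eqMixin (fps R).
HB.instance Definition _ (R : Type) := gen_choiceMixin (fps R).

Lemma fpsP (R : Type) (f g : fps R) : fcoef f =1 fcoef g -> f = g.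
Proof. by case: f g => [f] [g] /= /funext ->. Qed.

Section FpsRing.
Variable R : comNzRingType.
Implicit Types f g h : fps R.

Definition fps_const (c : R) : fps R := Fps (fun i => if i is 0 then c else 0).
Definition fps_add f g := Fps (fun i => fcoef f i + fcoef g i).
Definition fps_opp f := Fps (fun i => - fcoef f i).
Definition fps_mul f g :=
  Fps (fun n => \sum_(i < n.+1) fcoef f i * fcoef g (n - i)).
Definition fps_of_poly (p : {poly R}) : fps R := Fps (fun i => p`_i).

Definition fps_trunc n f : {poly R} := \poly_(i < n.+1) fcoef f i.

Lemma coef_trunc n f i : (i <= n)%N -> (fps_trunc n f)`_i = fcoef f i.
Proof. by move=> le_in; rewrite coef_poly ltnS le_in. Qed.

Lemma fps_mulE f g (p q : {poly R}) n :
    (forall i, (i <= n)%N -> p`_i = fcoef f i) ->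
    (forall i, (i <= n)%N -> q`_i = fcoef g i) ->
  forall i, (i <= n)%N -> (p * q)`_i = fcoef (fps_mul f g) i.
Proof.
move=> Hp Hq i le_in; rewrite coefM /=; apply: eq_bigr => j _.
rewrite Hp ?Hq // ?(leq_trans (leq_subr _ _)) //.
by rewrite (leq_trans _ le_in) // -ltnS.
Qed.

Fact fps_addA : associative fps_add.
Proof. by move=> f g h; apply: fpsP => i /=; rewrite addrA. Qed.
Fact fps_addC : commutative fps_add.
Proof. by move=> f g; apply: fpsP => i /=; rewrite addrC. Qed.
Fact fps_add0 : left_id (fps_const 0) fps_add.
Proof. by move=> f; apply: fpsP => -[|i] /=; rewrite add0r. Qed.
Fact fps_addN : left_inverse (fps_const 0) fps_opp fps_add.
Proof. by move=> f; apply: fpsP => -[|i] /=; rewrite addNr. Qed.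

HB.instance Definition _ :=
  GRing.isZmodule.Build (fps R) fps_addA fps_addC fps_add0 fps_addN.

Fact fps_mulA : associative fps_mul.
Proof.
move=> f g h; apply: fpsP => n.
have C := @coef_trunc n.
have Hfg := fps_mulE (C f) (C g); have Hgh := fps_mulE (C g) (C h).
rewrite -(fps_mulE (C f) Hgh) // -(fps_mulE Hfg (C h)) //.
by rewrite mulrA.
Qed.
Fact fps_mulC : commutative fps_mul.
Proof.
move=> f g; apply: fpsP => n; have C := @coef_trunc n.
by rewrite -(fps_mulE (C f) (C g)) // -(fps_mulE (C g) (C f)) // mulrC.
Qed.
Fact fps_mul1 : left_id (fps_const 1) fps_mul.
Proof.
move=> f; apply: fpsP => n /=.
rewrite big_ord_recl subn0 mul1r big1 ?addr0 // => i _; exact: mul0r.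
Qed.
Fact fps_mulD : left_distributive fps_mul fps_add.
Proof.
move=> f g h; apply: fpsP => n /=.
by rewrite -big_split; apply: eq_bigr => i _; rewrite mulrDl.
Qed.
Fact fps_1neq0 : fps_const 1 != fps_const 0.
Proof. by apply/eqP => -[] /(congr1 (@^~ 0%N)) /eqP; rewrite oner_eq0. Qed.

HB.instance Definition _ := GRing.Zmodule_isComNzRing.Build (fps R)
  fps_mulA fps_mulC fps_mul1 fps_mulD fps_1neq0.

Fact fps_of_poly_is_zmod_morphism : zmod_morphism fps_of_poly.
Proof. by move=> p q; apply: fpsP => i /=; rewrite coefB. Qed.
Fact fps_of_poly_is_monoid_morphism : monoid_morphism fps_of_poly.
Proof.
split=> [|p q]; apply: fpsP => n /=; last exact: coefM.
by rewrite coefC; case: n.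
Qed.
HB.instance Definition _ := GRing.isZmodMorphism.Build {poly R} (fps R)
  fps_of_poly fps_of_poly_is_zmod_morphism.
HB.instance Definition _ := GRing.isMonoidMorphism.Build {poly R} (fps R)
  fps_of_poly fps_of_poly_is_monoid_morphism.

Lemma fps_of_poly_inj : injective fps_of_poly.
Proof. by move=> p q [/funeqP Epq]; apply/polyP. Qed.

Lemma fps_of_poly_eq0 (p : {poly R}) : (fps_of_poly p == 0) = (p == 0).
Proof. by rewrite -(rmorph0 fps_of_poly) (inj_eq fps_of_poly_inj). Qed.

Definition fps_unit : pred (fps R) := fun f => `[< exists g, g * f = 1 >].
Definition fps_inv f : fps R :=
  if fps_unit f then xget 0 [set g | g * f = 1]%classic else f.

Fact fps_mulV : {in fps_unit, left_inverse 1 fps_inv *%R}.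
Proof.
move=> f uf; rewrite /fps_inv (uf : fps_unit f).
by move/asboolP: uf => uf; exact: (@xgetPex _ 0 [set g | g * f = 1]%classic).
Qed.
Fact fps_unitP f g : g * f = 1 -> fps_unit f.
Proof. by move=> gf1; apply/asboolP; exists g. Qed.
Fact fps_inv_out : {in [predC fps_unit], fps_inv =1 id}.
Proof. by move=> f nuf; rewrite /fps_inv (negPf (nuf : ~~ fps_unit f)). Qed.

HB.instance Definition _ := GRing.ComNzRing_hasMulInverse.Build (fps R)
  fps_mulV fps_unitP fps_inv_out.

End FpsRing.

Section FpsDomain.
Variable R : idomainType.

Lemma fps_neq0 (f : fps R) :
  f != 0 -> exists2 n, fcoef f n != 0 & forall i, (i < n)%N -> fcoef f i = 0.
Proof.
move=> nz_f; have ex_n: exists n, fcoef f n != 0.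
  apply: contrapT => none; case/eqP: nz_f; apply: fpsP => i.
  have ->: fcoef (0 : fps R) i = 0 by case: i.
  by apply: contrapT => /eqP nz_fi; case: none; exists i.
case: (ex_minnP ex_n) => n nz_fn min_n; exists n => // i lt_in.
by apply: contraTeq lt_in => /min_n; rewrite leqNgt.
Qed.

Fact fps_domain : GRing.integral_domain_axiom (fps R).
Proof.
move=> f g fg0; apply/norP => -[/fps_neq0[m nz_m min_m] /fps_neq0[n nz_n min_n]].
have: fcoef (f * g) (m + n) = fcoef f m * fcoef g n.
  have lt_m : (m < (m + n).+1)%N by rewrite ltnS leq_addr.
  rewrite [LHS](bigD1 (Ordinal lt_m)) //= addKn big1 ?addr0 // => i ne_im.
  have [lt_im | lt_mi | eq_im] := ltngtP i m.
  - by rewrite min_m ?mul0r.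
  - by rewrite min_n ?mulr0 // ltn_subLR ?ltn_add2r // -ltnS.
  - by case/eqP: ne_im; apply: val_inj.
rewrite fg0; have ->: fcoef (0 : fps R) (m + n) = 0 by case: (m + n)%N.
by move/esym/eqP; rewrite mulf_eq0 (negPf nz_m) (negPf nz_n).
Qed.

HB.instance Definition _ :=
  GRing.ComUnitRing_isIntegral.Build (fps R) fps_domain.

End FpsDomain.

Notation "x %:F" := (FracField.tofrac x) : ring_scope.

Section Fractions.
Variable K : fieldType.
Local Notation Kz := {fraction {poly K}}.
Local Notation Laurent := {fraction (fps K)}.

Lemma frac_repr (a : Kz) : a = (\n_(repr a))%:F / (\d_(repr a))%:F.
Proof.
have nz_d := denom_ratioP (repr a).
apply: (canRL (mulfK _)); first by rewrite tofrac_eq0.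
rewrite -{1}(reprK a); move: (repr a) nz_d => x nz_x.
unlock FracField.tofrac; rewrite -[LHS]FracField.pi_mul; apply/eqmodP.
rewrite /= FracField.equivfE /FracField.mulf.
by rewrite !numden_Ratio ?mulf_neq0 ?oner_neq0 // !mulr1 mulrC.
Qed.

(* The inclusion of K(z) in K((z)), the fraction field of K[[z]]. *)
Definition laurent_of_frac (a : Kz) : Laurent :=
  (fps_of_poly \n_(repr a))%:F / (fps_of_poly \d_(repr a))%:F.

Lemma laurent_of_fracE (s t : {poly K}) : t != 0 ->
  laurent_of_frac (s%:F / t%:F) = (fps_of_poly s)%:F / (fps_of_poly t)%:F.
Proof.
move=> nz_t; rewrite /laurent_of_frac; set a := s%:F / t%:F.
have nz_d := denom_ratioP (repr a).
have /eqP := frac_repr a; rewrite {1}/a eqr_div ?tofrac_eq0 //.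
rewrite -!tofracM tofrac_eq => /eqP Est.
apply/eqP; rewrite eqr_div ?tofrac_eq0 ?fps_of_poly_eq0 //.
by rewrite -!tofracM tofrac_eq -!(rmorphM (@fps_of_poly K)) -Est /= mulrC.
Qed.

Fact laurent_of_frac_is_zmod_morphism : zmod_morphism laurent_of_frac.
Proof.
move=> a b; rewrite {1}(frac_repr a) {1}(frac_repr b).
have nz_a := denom_ratioP (repr a); have nz_b := denom_ratioP (repr b).
rewrite -mulNr addf_div ?tofrac_eq0 // -tofracN -!tofracM -tofracD.
rewrite laurent_of_fracE ?mulf_neq0 // !(rmorphD, rmorphM, rmorphN) /=.
by rewrite -addf_div ?tofrac_eq0 ?fps_of_poly_eq0 // mulNr.
Qed.

Fact laurent_of_frac_is_monoid_morphism : monoid_morphism laurent_of_frac.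
Proof.
split=> [|a b].
  have ->: (1 : Kz) = 1%:F / 1%:F by rewrite tofrac1 divr1.
  by rewrite laurent_of_fracE ?oner_eq0 // !rmorph1 divr1.
rewrite {1}(frac_repr a) {1}(frac_repr b) mulf_div -!tofracM.
have nz_a := denom_ratioP (repr a); have nz_b := denom_ratioP (repr b).
by rewrite laurent_of_fracE ?mulf_neq0 // !rmorphM /= -mulf_div.
Qed.

HB.instance Definition _ := GRing.isZmodMorphism.Build Kz Laurent
  laurent_of_frac laurent_of_frac_is_zmod_morphism.
HB.instance Definition _ := GRing.isMonoidMorphism.Build Kz Laurent
  laurent_of_frac laurent_of_frac_is_monoid_morphism.

(* P(f) in K((z)), for P in K(z)[Y] and f in K[[z]]. *)
Definition eval_fps (P : {poly Kz}) (f : fps K) : Laurent :=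
  (map_poly laurent_of_frac P).[f%:F].

(* The numerator and denominator of repr a need not be coprime, so they are
   first divided by their gcd; see heightE. *)
Definition height (a : Kz) : nat :=
  let s := \n_(repr a) in let t := \d_(repr a) in
  (maxn (size (s %/ gcdp s t)) (size (t %/ gcdp s t))).-1.

Lemma heightE (s t : {poly K}) : t != 0 -> coprimep s t ->
  height (s%:F / t%:F) = maxn (size s).-1 (size t).-1.
Proof.
move=> nz_t co_st; rewrite /height; set a := s%:F / t%:F.
have nz_d := denom_ratioP (repr a).
have /eqP := frac_repr a; rewrite {1}/a eqr_div ?tofrac_eq0 //.
rewrite -!tofracM tofrac_eq => /eqP.
move: (\n_(repr a)) (\d_(repr a)) nz_d => u v nz_v Esv.
set g := gcdp u v.
have nz_g: g != 0 by rewrite gcdp_eq0 (negPf nz_v) andbF.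
have Eu: u = (u %/ g) * g by rewrite divpK ?dvdp_gcdl.
have Ev: v = (v %/ g) * g by rewrite divpK ?dvdp_gcdr.
have co_uv: coprimep (u %/ g) (v %/ g).
  by rewrite coprimep_div_gcd // nz_v orbT.
move: {Esv}(Esv); rewrite {1}Eu {1}Ev mulrA -mulrA [_ * t]mulrAC mulrA.
move/(mulIf nz_g); set u' := u %/ g in co_uv *; set v' := v %/ g in co_uv * => E.
have Et: t %= v'.
  apply/andP; split.
    by rewrite -(@Gauss_dvdpr _ v' s) 1?coprimep_sym // E dvdp_mull.
  by rewrite -(@Gauss_dvdpr _ t u') 1?coprimep_sym // -E dvdp_mull.
have Es: s %= u'.
  apply/andP; split.
    by rewrite -(@Gauss_dvdpl _ u' t s) // -E dvdp_mulr.
  by rewrite -(@Gauss_dvdpl _ s v' u') // E dvdp_mulr.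
rewrite -(eqp_size Et) -(eqp_size Es).
by case: (size s) (size t) => [|i] [|j]; rewrite ?max0n ?maxn0 ?maxnSS.
Qed.

Definition poly_height (P : {poly Kz}) : nat := \max_(i < size P) height (P`_i)%R.

End Fractions.

Section Hypergeometric.
Variable n : nat.
Implicit Types alpha beta : 'I_n -> rat.

Definition pochhammer (x : rat) (i : nat) : rat := \prod_(k < i) (x + k%:R).

(* beta is the full n-tuple, with last entry 1; the condition j.+1 < n selects
   beta_1, ..., beta_(n-1). *)
Definition hyp_coef alpha beta (i : nat) : rat :=
  (\prod_(j < n) pochhammer (alpha j) i) /
  ((\prod_(j < n | (j.+1 < n)%N) pochhammer (beta j) i) * (i`!)%:R).

Definition hypergeometric alpha beta : fps rat := Fps (hyp_coef alpha beta).

Definition common_den alpha beta : nat :=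
  lcmn (\big[lcmn/1%N]_(j < n) `|denq (alpha j)|%N)
       (\big[lcmn/1%N]_(j < n | (j.+1 < n)%N) `|denq (beta j)|%N).

End Hypergeometric.

Section Padic.
Variable p : nat.

(* Membership in the localization of Z at (p). *)
Definition zloc (x : rat) : bool := ~~ (p %| `|denq x|)%N.

(* Meaningful for x != 0 only: the value at 0 is 0 rather than infinity. *)
Definition vp (x : rat) : int :=
  (logn p `|numq x|)%:Z - (logn p `|denq x|)%:Z.

(* Reduction Z_(p) -> F_p: ratr divides the numerator by the denominator
   in 'F_p. *)
Definition redp (x : rat) : 'F_p := ratr x.

Definition dwork (x : rat) : rat :=
  xget 0 [set y | zloc y /\
                  exists2 r : nat, (r < p)%N & p%:R * y - x = r%:R]%classic.

Definition dwork_tuple (n : nat) (a : 'I_n -> rat) : 'I_n -> rat :=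
  fun i => dwork (a i).

Definition E_set (n : nat) (beta : 'I_n -> rat) : {set 'I_p} :=
  [set r : 'I_p | ((r : nat)%:R == 0 :> 'F_p) ||
     [exists j : 'I_n, (j.+1 < n)%N && ((r : nat)%:R == redp (1 - beta j))]].

Definition S_set (n : nat) (alpha beta : 'I_n -> rat) : {set 'I_p} :=
  [set r in E_set beta | (hyp_coef alpha beta r != 0)
                           && (vp (hyp_coef alpha beta r) == 0)].

End Padic.

Lemma zloc_div (p : nat) (N D : int) :
  ~~ (p %| `|D|)%N -> zloc p (N%:~R / D%:~R).
Proof.
case: divqP => [|k x _]; first by rewrite dvdn0.
by rewrite /zloc abszM; apply: contra => /dvdn_mull->.
Qed.

Lemma dworkP (p : nat) (x : rat) : prime p -> zloc p x ->
  zloc p (dwork p x) /\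
  (exists2 r : nat, (r < p)%N & p%:R * dwork p x - x = r%:R).
Proof.
move=> p_pr x_loc; rewrite /dwork.
have chp := pchar_Fp p_pr.
have nz_p : p%:R != 0 :> rat by rewrite pnatr_eq0 -lt0n prime_gt0.
have nz_D : (denq x)%:~R != 0 :> 'F_p by rewrite -(dvdz_pcharf chp) dvdzE.
set r : nat := val (- redp p x : 'F_p).
have /dvdzP[k Ek] : (p %| numq x + r%:Z * denq x)%Z.
  rewrite (dvdz_pcharf chp) rmorphD rmorphM /= -[_%:~R in X in _ + X]/(r%:R).
  by rewrite natr_Zp mulNr /redp /ratr divfK // subrr.
pose P y := zloc p y /\ exists2 r : nat, (r < p)%N & p%:R * y - x = r%:R.
apply: (@xgetPex _ 0 P); exists (k%:~R / (denq x)%:~R).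
split; first exact: zloc_div.
exists r; first by have := ltn_ord (- redp p x); rewrite [X in (_ < X)%N](Fp_cast p_pr).
have nz_d : (denq x)%:~R != 0 :> rat by rewrite intr_eq0 denq_eq0.
apply: (mulIf nz_d); rewrite mulrBl mulrA divfK //.
have -> : x * (denq x)%:~R = (numq x)%:~R by rewrite -{1}[x]divq_num_den divfK.
have /(congr1 (fun z : int => z%:~R : rat)) := Ek.
rewrite rmorphD !rmorphM /= => E.
by apply/eqP; rewrite subr_eq mulrC addrC -E.
Qed.

Lemma dwork_unique (p : nat) (x y : rat) r : prime p -> zloc p x ->
  zloc p y -> (r < p)%N -> p%:R * y - x = r%:R -> dwork p x = y.
Proof.
move=> p_pr x_loc y_loc lt_rp Ey.
have [z_loc [s lt_sp Ez]] := dworkP p_pr x_loc.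
move: (dwork p x) z_loc Ez => z z_loc Ez.
have nz_p : p%:R != 0 :> rat by rewrite pnatr_eq0 -lt0n prime_gt0.
have Eyz : p%:R * (z - y) = (s%:Z - r%:Z)%:~R :> rat.
  by rewrite rmorphB /= -[s%:~R]/(s%:R) -[r%:~R]/(r%:R) -Ez -Ey; ring.
have nz_y : (denq y)%:~R != 0 :> rat by rewrite intr_eq0 denq_eq0.
have nz_z : (denq z)%:~R != 0 :> rat by rewrite intr_eq0 denq_eq0.
have Ei : (p%:Z * (numq z * denq y - numq y * denq z) =
           (s%:Z - r%:Z) * (denq z * denq y))%R.
  apply: (@intr_inj rat); apply/esym.
  have -> (u v : int) : (u * v)%:~R = u%:~R * v%:~R :> rat by rewrite rmorphM.
  rewrite -Eyz -{1}[z]divq_num_den -{1}[y]divq_num_den.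
  by rewrite !(rmorphM, rmorphB) /= -[(Posz p)%:~R]/(p%:R); field; apply/andP; split.
have: (p %| `|((s%:Z - r%:Z) * (denq z * denq y))%R|)%N.
  by rewrite -Ei abszM dvdn_mulr.
rewrite !abszM !Euclid_dvdM // (negPf y_loc) (negPf z_loc) !orbF => p_sr.
have Esr : s = r.
  by move: p_sr; case: (ltngtP s r) => // lt; move/dvdn_leq; lia.
apply: (mulfI nz_p); apply/eqP; rewrite -subr_eq0 -mulrBr Eyz Esr subrr //.
Qed.

(* The order of a in the unit group of Z/dZ, for d > 1 and a prime to d. *)
Definition mod_order (d a : nat) : nat :=
  #[insubd (1%g : {unit 'Z_d}) (a%:R : 'Z_d)]%g.

Lemma mod_orderP (d a : nat) k : (1 < d)%N -> coprime d a ->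
  (mod_order d a %| k)%N = (a ^ k == 1 %[mod d])%N.
Proof.
move=> d_gt1 co_da; rewrite /mod_order order_dvdn -val_eqE FinRing.val_unitX.
rewrite val_insubd unitZpE // co_da -natrX.
by rewrite FinRing.val_unit1 -!val_Zp_nat // val_eqE.
Qed.

(* Main.v *)
Require Import Defs.
From HB Require Import structures.
From mathcomp Require Import all_boot all_order all_algebra.
From mathcomp Require Import all_fingroup generic_quotient.
From mathcomp Require Import cyclic finfield zify ring lra.
From mathcomp Require Import boolp.

Import Order.TTheory GRing.Theory Num.Theory.
Local Open Scope ring_scope.

(* Let D be the Dwork map, x' = D(x) and rho = p x' - x.  Among x, x + 1, ... the
   multiples of p are p x', p (x' + 1), ..., starting at x + rho, so (x)_(pk+r)
   is p^(k+[rho<r]) (x')_(k+[rho<r]) times a unit whose residue depends on k only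
   through a factor common to all x.  Taking quotients,
   Q_(alpha,beta)(pk + r) is p^(#A_r - #B_r) times a unit of residue independent
   of k times the coefficient at k of the series with parameters
   D(alpha) + [A_r], D(beta) + [B_r], where A_r and B_r are the sets of indices
   with rho < r.  Integrality of f forces #B_r <= #A_r, so modulo p only the r
   with #A_r = #B_r survive, and there are at most #S such pairs (A_r, B_r).
   The same holds for the shifted series, with the same pairs.  After l steps the
   parameters come back: with q = p^l, f = sum_tau W_(k,tau) g_tau^(q^k) for
   every k, with deg W_(k,tau) < q^k and at most N = #S series g_tau.

   Hence f, f^q, ..., f^(q^N) are combinations of the at most N series
   g_tau^(q^N) with polynomial coefficients of degree < q^N; counting gives a
   relation sum_i c_i f^(q^i) = 0 with c not zero and deg c_i <= N (q^N - 1), and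
   extracting q-th roots makes c_0 nonzero.  As N <= 2^(N-1), dividing by c_0
   gives a polynomial of the required shape. *)

Set Implicit Arguments.
Unset Strict Implicit.
Unset Printing Implicit Defensive.

(** * Formal power series and Frobenius *)

Section FpsSections.
Variable R : comNzRingType.
Implicit Types f g : fps R.

Lemma fcoef0 i : fcoef (0 : fps R) i = 0.
Proof. by case: i. Qed.

Lemma fcoef_sum (I : Type) (r : seq I) (P : pred I) (F : I -> fps R) i :
  fcoef (\sum_(j <- r | P j) F j) i = \sum_(j <- r | P j) fcoef (F j) i.
Proof. by elim/big_rec2: _ => [|j x y _ <-] //; rewrite fcoef0. Qed.

(** The series f(z^q). Over F_p, when q is a power of p, it equals f^q ([fps_exp_pexp]). *)
Definition fps_subst (q : nat) f : fps R :=
  Fps (fun i => if (q %| i)%N then fcoef f (i %/ q) else 0).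

(* f is the sum over a < q of z^a times its section at a, taken at z^q. *)
Definition fps_section (q a : nat) f : fps R :=
  Fps (fun i => fcoef f (q * i + a)).

Lemma fps_section0 q a : fps_section q a 0 = 0.
Proof. by apply: fpsP => i; rewrite fcoef0 -[LHS]/(fcoef 0 _) fcoef0. Qed.

Lemma fps_section_sum (I : Type) (r : seq I) (P : pred I) (F : I -> fps R) q a :
  fps_section q a (\sum_(j <- r | P j) F j) =
  \sum_(j <- r | P j) fps_section q a (F j).
Proof. by apply: fpsP => i; rewrite fcoef_sum [LHS]/= fcoef_sum. Qed.

Lemma fps_section_inj q f g : (0 < q)%N ->
  (forall a, (a < q)%N -> fps_section q a f = fps_section q a g) -> f = g.
Proof.
move=> q_gt0 Efg; apply: fpsP => i.
have /(congr1 (fun h => fcoef h (i %/ q))) /= := Efg _ (ltn_pmod i q_gt0).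
by rewrite mulnC -divn_eq.
Qed.

Lemma fps_section_poly q a (P : {poly R}) : (size P <= q)%N -> (a < q)%N ->
  fps_section q a (fps_of_poly P) = fps_of_poly (P`_a)%:P.
Proof.
move=> le_Pq lt_aq; apply: fpsP => -[|i] /=; rewrite coefC ?muln0 //=.
by rewrite nth_default // (leq_trans le_Pq) // mulnS -addnA leq_addr.
Qed.

Lemma fcoef_polyC_mul (c : R) f i : fcoef (fps_of_poly c%:P * f) i = c * fcoef f i.
Proof.
rewrite /= big_ord_recl coefC subn0 big1 ?addr0 // => j _.
by rewrite coefC mul0r.
Qed.

(** Only the multiples q j contribute, and those up to q k + a have j <= k because a < q. This is
    the convolution behind a product with G(z^q). *)
Lemma sum_dvdn (q a k : nat) (G H : nat -> R) : (a < q)%N ->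
  \sum_(i < (q * k + a).+1) (if (q %| i)%N then G (i %/ q)%N else 0) * H i =
  \sum_(j < k.+1) G j * H (q * j)%N.
Proof.
move=> lt_aq; have q_gt0 : (0 < q)%N by apply: leq_trans lt_aq.
pose F i := (if (q %| i)%N then G (i %/ q)%N else 0) * H i.
have block c b : (b < q)%N ->
    \sum_(q * c <= i < (q * c + b).+1) F i = G c * H (q * c)%N.
  elim: b => [|b IHb] lt_bq.
    by rewrite addn0 big_nat1 /F dvdn_mulr // mulKn.
  rewrite addnS big_nat_recr ?IHb; [|lia..].
  rewrite /F -addnS /dvdn mulnC modnMDl modn_small //= mul0r addr0.
  by rewrite mulnC.
rewrite -(big_mkord xpredT F) -(big_mkord xpredT (fun j => G j * H (q * j)%N)).
elim: k => [|k IHk].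
  by rewrite big_nat1 -(@block 0%N a) // muln0.
rewrite [RHS]big_nat_recr //= (big_cat_nat (leq0n (q * k.+1))) /=; last lia.
rewrite block //; congr (_ + _).
have lt1 : (q.-1 < q)%N by rewrite ltn_predL.
have -> : (q * k.+1 = (q * k + q.-1).+1)%N by rewrite -addnS prednK // mulnS addnC.
rewrite (big_cat_nat (leq0n (q * k))) /= ?block //; last lia.
have le : (q * k <= (q * k + a).+1)%N by lia.
by move: IHk; rewrite (big_cat_nat (leq0n (q * k)) le) /= block.
Qed.

(** A factor g(z^q) does not mix the residue classes of exponents modulo q, so taking a section is
    linear over series in z^q. *)
Lemma fps_section_mul_subst (q a : nat) f g : (a < q)%N ->
  fps_section q a (f * fps_subst q g) = fps_section q a f * g.
Proof.
move=> lt_aq; rewrite mulrC [RHS]mulrC; apply: fpsP => k /=.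
rewrite (sum_dvdn k (fcoef g) (fun i => fcoef f (q * k + a - i)) lt_aq).
apply: eq_bigr => j _; congr (_ * fcoef f _).
have := ltn_ord j; rewrite ltnS => le_jk.
by rewrite mulnBr addnBAC // leq_mul2l le_jk orbT.
Qed.

End FpsSections.

Section Frobenius.
Variable p : nat.
Hypothesis p_pr : prime p.
Implicit Types f g : fps 'F_p.

Lemma fps_pchar : p \in [pchar (fps 'F_p)].
Proof.
apply/andP; split=> //; apply/eqP; apply: fpsP => i.
have -> : p%:R = fps_of_poly (p%:R : {poly 'F_p}) by rewrite rmorph_nat.
by rewrite -polyC_natr pchar_Fp_0 // fcoef0 /= coefC if_same.
Qed.

Lemma fps_pexp_pchar e : [pchar (fps 'F_p)].-nat (p ^ e)%N.
Proof. by rewrite pnatX pnatE // fps_pchar. Qed.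

Lemma fps_Frob_sum (I : Type) (r : seq I) (P : pred I) (F : I -> fps 'F_p) e :
  (\sum_(j <- r | P j) F j) ^+ (p ^ e) = \sum_(j <- r | P j) F j ^+ (p ^ e).
Proof.
have p_gt0 := prime_gt0 p_pr.
elim/big_rec2: _ => [|j x y _ <-]; first by rewrite expr0n expn_eq0 eqn0Ngt p_gt0.
exact: exprDn_pchar (fps_pexp_pchar e).
Qed.

(** Write f = c + z g. Frobenius is additive and fixes c, so f^p = c + z^p g^p, and for i >= p the
    coefficient at i is reduced to that of g^p at i - p; the induction on i runs over all series at
    once. *)
Lemma fps_exp_pchar f : f ^+ p = fps_subst p f.
Proof.
have p_gt0 := prime_gt0 p_pr.
have coefXnM k (h : fps 'F_p) i :
    fcoef (fps_of_poly 'X^k * h) i = if (i < k)%N then 0 else fcoef h (i - k).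
  rewrite /= (eq_bigr (fun j : 'I_i.+1 => if val j == k then fcoef h (i - k) else 0)).
    rewrite -big_mkcond /=; case: ltnP => [lt_ik | le_ki].
      by rewrite big_pred0 // => j; have := ltn_ord j; apply: contraTF => /eqP->; lia.
    by rewrite -ltnS in le_ki; rewrite (big_pred1 (Ordinal le_ki)).
  by move=> j _; rewrite coefXn; case: eqP => [->|_]; rewrite ?mul1r ?mul0r.
have fermat (c : 'F_p) : c ^+ p = c.
  have := expf_card c; by rewrite card_Fp.
apply: fpsP => i; elim/ltn_ind: i f => i IHi f.
pose g : fps 'F_p := Fps (fun k => fcoef f k.+1).
have Ef : f = fps_of_poly (fcoef f 0)%:P + fps_of_poly 'X * g.
  apply: fpsP => -[|k].
    by rewrite [RHS]/= coefC big_ord1 coefX mul0r addr0.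
  rewrite -[RHS]/(_ + fcoef (fps_of_poly 'X^1 * g) k.+1) coefXnM subn1 /=.
  by rewrite coefC add0r.
have Ep (x y : fps 'F_p) : (x + y) ^+ p = x ^+ p + y ^+ p.
  by have := fps_pexp_pchar 1; rewrite expn1; apply: exprDn_pchar.
rewrite {1}Ef Ep exprMn -!rmorphXn /= fermat.
rewrite -[LHS]/((fcoef f 0)%:P`_i + fcoef (fps_of_poly 'X^p * g ^+ p) i).
rewrite coefXnM coefC; case: ltnP => [lt_ip | le_pi].
  by case: i lt_ip {IHi} => [|i] lt_ip; rewrite ?dvdn0 ?div0n addr0 // gtnNdvd.
rewrite IHi; last lia.
have /negPf-> : i != 0%N by lia.
rewrite add0r /= -{3 4}(subnK le_pi) dvdn_addl // divnDr // divnn p_gt0.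
by rewrite addn1.
Qed.

Lemma fps_subst_comp q q' (f : fps 'F_p) : (0 < q')%N ->
  fps_subst q' (fps_subst q f) = fps_subst (q * q') f.
Proof.
move=> q'_gt0; apply: fpsP => i /=.
have [q'_i | nq'_i] := boolP (q' %| i)%N.
  by rewrite dvdn_divRL // -divnMA (mulnC q').
by case: ifP => // qq'_i; rewrite (dvdn_trans (dvdn_mull q (dvdnn q'))) in nq'_i.
Qed.

Lemma fps_exp_pexp f e : f ^+ (p ^ e) = fps_subst (p ^ e) f.
Proof.
elim: e => [|e IHe].
  by rewrite expr1; apply: fpsP => i /=; rewrite dvd1n divn1.
by rewrite expnSr exprM IHe fps_exp_pchar fps_subst_comp ?prime_gt0.
Qed.

End Frobenius.

(** * Frobenius relations of bounded degree *)

(** Pigeonhole: there are more tuples of N + 1 polynomials of size at most D than possible values of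
    their combinations, and the difference of two tuples with the same values is a relation. *)
Lemma poly_relation (F : finFieldType) (I : finType) (T : {set I}) (N Q : nat)
    (V : 'I_N.+1 -> I -> {poly F}) :
    (0 < Q)%N -> (#|T| <= N)%N -> (forall i t, (size (V i t) <= Q)%N) ->
  exists c : 'I_N.+1 -> {poly F},
    [/\ exists i, c i != 0, forall i, (size (c i) <= (N * Q.-1).+1)%N &
        forall t, t \in T -> \sum_i c i * V i t = 0].
Proof.
move=> Q_gt0 leTN size_V; pose D := (N * Q.-1).+1; pose E := (D + Q.-1)%N.
pose comb (x : {ffun 'I_N.+1 -> 'rV[F]_D}) t := \sum_i rVpoly (x i) * V i t.
pose h x := [ffun t : {t | t \in T} => poly_rV (comb x (val t)) : 'rV[F]_E].
have size_comb x t : (size (comb x t) <= E)%N.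
  apply: leq_trans (size_sum _ _ _) _; apply/bigmax_leqP => i _.
  apply: leq_trans (size_polyMleq _ _) _.
  have := size_V i t; have : (size (rVpoly (x i)) <= D)%N by exact: size_poly.
  by rewrite /E; lia.
have /injectivePn[x [y ne_xy Eh]] : ~~ injectiveb h.
  apply/injectiveP => /leq_card; rewrite !card_ffun card_sig !card_mx card_ord !mul1n -!expnM.
  rewrite leq_exp2l ?finNzRing_gt1 // (_ : #|_| = #|T|); last exact: eq_card.
  have : (E * #|T| <= E * N)%N by rewrite leq_mul2l leTN orbT.
  (* The value of D is just large enough: D (N + 1) - E N = 1. *)
  have : (E * N < D * N.+1)%N by rewrite /E /D; lia.
  by lia.
exists (fun i => rVpoly (x i - y i)); split.
- have [/forallP E0 | ] := boolP [forall i, x i == y i].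
    by case/eqP: ne_xy; apply/ffunP => i; apply/eqP.
  rewrite negb_forall => /existsP[i ne_i]; exists i.
  apply: contraNneq ne_i => /(congr1 (@poly_rV _ D)).
  by rewrite rVpolyK linear0 => /eqP; rewrite subr_eq0.
- by move=> i; exact: size_poly.
move=> t Tt; have /ffunP/(_ (exist _ t Tt)) := Eh; rewrite !ffunE /=.
move/(congr1 rVpoly); rewrite !poly_rV_K // => Exy.
rewrite -[RHS](subrr (comb y t)) -{1}Exy -sumrB.
by apply: eq_bigr => i _; rewrite linearB mulrBl.
Qed.

Section FrobeniusRelation.
Variables (p l : nat).
Hypotheses (p_pr : prime p) (l_gt0 : (0 < l)%N).
Let q := (p ^ l)%N.

(* If the lowest nonzero coefficient is c_i0, decompose every c_i as the sum of
   z^a c_{i,a}(z^Q) with Q = q^i0; the relation is then the sum of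
   z^a (sum_i c_{i,a} f^(q^(i-i0)))^Q, so each of the inner sums vanishes. *)
Lemma relation_shift (N D : nat) (f : fps 'F_p) (c : 'I_N.+1 -> {poly 'F_p}) :
    (exists i, c i != 0) -> (forall i, (size (c i) <= D)%N) ->
    \sum_i fps_of_poly (c i) * f ^+ (q ^ i) = 0 ->
  exists c' : 'I_N.+1 -> {poly 'F_p},
    [/\ c' ord0 != 0, forall i, (size (c' i) <= D)%N &
        \sum_i fps_of_poly (c' i) * f ^+ (q ^ i) = 0].
Proof.
move=> [i1 nz_i1] size_c c_rel.
have q_gt0 : (0 < q)%N by rewrite expn_gt0 prime_gt0.
(* Extension by zero, so that indices may be shifted beyond N. *)
pose C i := if insub i is Some j then c j else 0.
have CE (i : 'I_N.+1) : C i = c i by rewrite /C valK.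
have exC : exists i, C i != 0 by exists i1; rewrite CE.
have size_C i : (size (C i) <= D)%N.
  by rewrite /C; case: insubP => [j _ _ | _] //; rewrite size_poly0.
have out_C i : (N < i)%N -> C i = 0.
  by move=> lt_Ni; rewrite /C insubF // ltnS leqNgt lt_Ni.
have [m nz_m min_m] := ex_minnP exC.
have le_mN : (m <= N)%N by rewrite leqNgt; apply: contra nz_m => /out_C ->.
(* One residue class suffices: that of the degree of c_m, whose section contains the leading
   coefficient. *)
have [a lt_a nz_a] : exists2 a, (a < q ^ m)%N & exists k, (C m)`_(q ^ m * k + a) != 0.
  exists ((size (C m)).-1 %% q ^ m)%N; first by rewrite ltn_mod expn_gt0 q_gt0.
  exists ((size (C m)).-1 %/ q ^ m)%N.
  by rewrite mulnC -divn_eq -lead_coefE lead_coef_eq0.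
pose sect i : {poly 'F_p} := \poly_(k < D) (C i)`_(q ^ m * k + a).
have sectE i : fps_of_poly (sect i) = fps_section (q ^ m) a (fps_of_poly (C i)).
  apply: fpsP => k /=; rewrite coef_poly; case: ltnP => // le_Dk.
  rewrite nth_default //; apply: leq_trans (size_C i) _; apply: leq_trans le_Dk _.
  by apply: leq_trans (leq_addr _ _); rewrite leq_pmull // expn_gt0 q_gt0.
exists (fun i => sect (i + m)%N); split.
- have [k nz_k] := nz_a; apply: contraNneq nz_k => /(congr1 (@fps_of_poly _)).
  by rewrite add0n sectE rmorph0 => /(congr1 (fun u => fcoef u k)) /= ->; case: k.
- by move=> i; exact: size_poly.
pose G i := fps_of_poly (C i) * f ^+ (q ^ i).
pose H i := fps_of_poly (sect (i + m)) * f ^+ (q ^ i).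
have GH i : H i = fps_section (q ^ m) a (G (i + m)%N).
  rewrite /H /G sectE expnD -{2}(expnM p l m) exprM -expnM fps_exp_pexp //.
  by rewrite expnM fps_section_mul_subst.
have : fps_section (q ^ m) a (\sum_(0 <= i < N.+1) G i) = 0.
  rewrite big_mkord (eq_bigr (fun i : 'I_N.+1 => fps_of_poly (c i) * f ^+ (q ^ i))).
    by rewrite c_rel fps_section0.
  by move=> i _; rewrite /G CE.
have le_mN1 : (m <= N.+1)%N by apply: leqW.
rewrite (big_cat_nat (leq0n m) le_mN1) /= big_nat big1 ?add0r; last first.
  move=> i /andP[_ lt_im]; rewrite /G; have [->|/min_m] := eqVneq (C i) 0.
    by rewrite rmorph0 mul0r.
  by rewrite leqNgt lt_im.
rewrite (_ : \sum_(m <= i < N.+1) G i = \sum_(0 <= i < N.+1 - m) G (i + m)%N); last first.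
  by rewrite -{1}[m]add0n big_addn.
move=> G0.
rewrite -(big_mkord xpredT H) (big_cat_nat (leq0n (N.+1 - m)) (leq_subr _ _)) /=.
rewrite [X in _ + X]big_nat [X in _ + X]big1 ?addr0; last first.
  move=> i /andP[le_i _]; rewrite /H sectE out_C; last lia.
  by rewrite rmorph0 fps_section0 mul0r.
rewrite -[RHS]G0 fps_section_sum.
by apply: eq_bigr => i _; rewrite GH.
Qed.

Lemma frobenius_relation (I : finType) (T : {set I}) (N : nat)
    (f : fps 'F_p) (g : I -> fps 'F_p) : (#|T| <= N)%N ->
    (forall k, exists W : I -> {poly 'F_p}, (forall t, (size (W t) <= q ^ k)%N) /\
       f = \sum_(t in T) fps_of_poly (W t) * g t ^+ (q ^ k)) ->
  exists c : 'I_N.+1 -> {poly 'F_p},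
    [/\ c ord0 != 0, forall i, (size (c i) <= (N * (q ^ N).-1).+1)%N &
        \sum_i fps_of_poly (c i) * f ^+ (q ^ i) = 0].
Proof.
move=> leTN /choice[W W_prop].
have q_gt0 : (0 < q)%N by rewrite expn_gt0 prime_gt0.
(* The expansion of level N - i is raised to the power q^i, so that all the f^(q^i) are combinations
   of the same series g_t^(q^N). *)
pose V (i : 'I_N.+1) t := W (N - i)%N t ^+ (q ^ i).
have VE (i : 'I_N.+1) :
    f ^+ (q ^ i) = \sum_(t in T) fps_of_poly (V i t) * g t ^+ (q ^ N).
  have Eqi : (q ^ i = p ^ (l * i))%N by rewrite expnM.
  have [_ {1}->] := W_prop (N - i)%N; rewrite Eqi fps_Frob_sum // -Eqi.
  apply: eq_bigr => t _; rewrite exprMn rmorphXn /= -exprM -expnD subnK //.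
  by rewrite -ltnS.
have size_V i t : (size (V i t) <= q ^ N)%N.
  rewrite /V; have [-> | nz_W] := eqVneq (W (N - i)%N t) 0.
    by rewrite expr0n eqn0Ngt expn_gt0 q_gt0 size_poly0.
  have [sz _] := W_prop (N - i)%N.
  have -> : (q ^ N = q ^ (N - i) * q ^ i)%N by rewrite -expnD subnK // -ltnS.
  rewrite (leq_trans (leqSpred _)) // size_exp ltn_mul2r expn_gt0 q_gt0 /=.
  by rewrite prednK ?size_poly_gt0.
have qN_gt0 : (0 < q ^ N)%N by rewrite expn_gt0 q_gt0.
have [c [nz_c size_c c_rel]] := poly_relation qN_gt0 leTN size_V.
apply: relation_shift nz_c size_c _.
under eq_bigr do rewrite VE mulr_sumr.
rewrite exchange_big big1 //= => t Tt.
under eq_bigr do rewrite mulrA -rmorphM /=.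
by rewrite -mulr_suml -rmorph_sum c_rel // rmorph0 mul0r.
Qed.

End FrobeniusRelation.

(** * Heights of additive polynomials *)

Section Additive.
Variable K : fieldType.
Local Notation Kz := {fraction {poly K}}.

(** Dividing by the gcd puts the fraction in lowest form, where [heightE] applies, and raises no
    degree. *)
Lemma height_div_le (s t : {poly K}) h : t != 0 ->
  (size s <= h.+1)%N -> (size t <= h.+1)%N -> (height (s%:F / t%:F) <= h)%N.
Proof.
move=> nz_t le_s le_t; pose g := gcdp s t.
have nz_g : g != 0 by rewrite gcdp_eq0 (negPf nz_t) andbF.
have nz_tg : t %/ g != 0 by rewrite dvdp_div_eq0 ?dvdp_gcdr.
have -> : s%:F / t%:F = (s %/ g)%:F / (t %/ g)%:F.
  apply/eqP; rewrite eqr_div ?tofrac_eq0 // -!tofracM tofrac_eq.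
  rewrite -[X in _ == _ * X](divpK (dvdp_gcdr s t)).
  by rewrite -{1}(divpK (dvdp_gcdl s t)) -/g; apply/eqP; ring.
rewrite heightE //; last by rewrite coprimep_div_gcd // nz_t orbT.
have le1 (u : {poly K}) : (size u <= h.+1)%N -> ((size (u %/ g)%R).-1 <= h)%N.
  by move=> le_u; rewrite -subn1 leq_subLR add1n (leq_trans (leq_divp u g)).
by rewrite geq_max !le1.
Qed.

Lemma height0 : height (0 : Kz) = 0%N.
Proof.
apply/eqP; rewrite -leqn0 -(mul0r (1%:F)^-1) -[0]tofrac0.
by rewrite height_div_le ?oner_eq0 ?size_poly0 ?size_poly1.
Qed.

Lemma height1 : height (1 : Kz) = 0%N.
Proof.
by apply/eqP; rewrite -leqn0 -(divr1 1) -[1]tofrac1 height_div_le ?oner_eq0 ?size_poly1.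
Qed.

Lemma laurent_of_poly (s : {poly K}) :
  laurent_of_frac s%:F = (fps_of_poly s)%:F.
Proof.
rewrite -[s%:F]divr1 -tofrac1 laurent_of_fracE ?oner_eq0 //.
by rewrite rmorph1 tofrac1 divr1.
Qed.

Variables (q N : nat) (Q : nat -> Kz).
Hypothesis q_gt1 : (1 < q)%N.
Let P := 'X - \sum_(1 <= i < N.+1) Q i *: 'X^(q ^ i).

Lemma coef_additive_poly j : P`_j =
  (j == 1%N)%:R - \sum_(1 <= i < N.+1) (if j == (q ^ i)%N then Q i else 0).
Proof.
rewrite coefB coefX coef_sum; congr (_ - _); apply: eq_bigr => i _.
by rewrite coefZ coefXn; case: eqP; rewrite ?mulr1 ?mulr0.
Qed.

(** The exponents 1 and q^i with i > 0 are pairwise distinct, so every coefficient is 1, 0 or some -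
    Q i. *)
Lemma poly_height_additive h : (forall i, height (- Q i) <= h)%N ->
  (poly_height P <= h)%N.
Proof.
move=> le_h; apply/bigmax_leqP => j _; rewrite coef_additive_poly.
have qi_gt1 i : (0 < i)%N -> (1 < q ^ i)%N.
  by move=> i_gt0; rewrite -(expn0 q) ltn_exp2l.
have [/eqP j1 | ne_j1] := boolP (val j == 1%N).
  rewrite j1 big_nat big1 ?subr0 ?height1 // => i /andP[/qi_gt1 + _].
  by case: eqP => // <-.
rewrite sub0r.
have [/hasP[i] | /hasPn none] :=
  boolP (has (fun i => val j == (q ^ i)%N) (index_iota 1 N.+1)).
  move=> i_in /eqP Ej; rewrite (big_rem i) //= Ej eqxx big_seq big1 ?addr0 //.
  move=> i'; rewrite mem_rem_uniq ?iota_uniq // inE => /andP[ne_ii' _].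
  by case: eqP => // /eqP; rewrite eqn_exp2l // eq_sym (negPf ne_ii').
rewrite big_seq big1 ?oppr0 ?height0 // => i /none.
by case: eqP.
Qed.

Lemma additive_poly_neq0 : P != 0.
Proof.
have : P`_1 != 0; last by apply: contraNneq => ->; rewrite coef0.
rewrite coef_additive_poly big_nat big1 ?subr0 ?oner_eq0 // => i /andP[i_gt0 _].
by case: eqP => // /esym/eqP; rewrite -(expn0 q) eqn_exp2l // -leqn0 leqNgt i_gt0.
Qed.

Lemma size_additive_poly : ((size P).-1 <= q ^ N)%N.
Proof.
rewrite -subn1 leq_subLR add1n; apply/leq_sizeP => j lt_j.
rewrite coef_additive_poly big_nat big1 => [|i /andP[_ le_iN]].
  have : (0 < q ^ N)%N by rewrite expn_gt0; case: (q) q_gt1.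
  by rewrite subr0; case: eqP => //; lia.
rewrite ltnS in le_iN; case: eqP => // Ej.
by move: lt_j; rewrite Ej ltn_exp2l // ltnNge le_iN.
Qed.

Lemma eval_additive_poly (f : fps K) : eval_fps P f =
  f%:F - \sum_(1 <= i < N.+1) laurent_of_frac (Q i) * (f ^+ (q ^ i))%:F.
Proof.
rewrite /eval_fps rmorphB /= map_polyX hornerD hornerN hornerX rmorph_sum horner_sum.
congr (_ - _); apply: eq_bigr => i _.
by rewrite /= map_polyZ map_polyXn hornerZ hornerXn tofracXn.
Qed.

End Additive.

(** Divide the relation by c_0, that is, take Q_i = - c_i / c_0. *)
Lemma additive_poly_of_relation (K : fieldType) (q N D : nat) (f : fps K)
    (c : 'I_N.+1 -> {poly K}) :
    (1 < q)%N -> c ord0 != 0 -> (forall i, (size (c i) <= D.+1)%N) ->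
    \sum_i fps_of_poly (c i) * f ^+ (q ^ i) = 0 ->
  exists Q : nat -> {fraction {poly K}},
    let P := 'X - \sum_(1 <= i < N.+1) Q i *: 'X^(q ^ i) in
    [/\ forall i, (N < i)%N -> Q i = 0, (poly_height P <= D)%N & eval_fps P f = 0].
Proof.
move=> q_gt1 nz_c size_c c_rel.
pose C i := if insub i is Some j then c j else 0.
have CE (i : 'I_N.+1) : C i = c i by rewrite /C valK.
have size_C i : (size (C i) <= D.+1)%N.
  by rewrite /C; case: insubP => [j _ _ | _] //; rewrite size_poly0.
have nz_C : C 0%N != 0 by rewrite (CE ord0).
exists (fun i => - ((C i)%:F / (C 0%N)%:F)) => P; split.
- move=> i lt_Ni; rewrite /C insubF ?tofrac0 ?mul0r ?oppr0 //.
  by rewrite ltnS leqNgt lt_Ni.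
- apply: poly_height_additive => // i; rewrite opprK.
  exact: height_div_le.
rewrite eval_additive_poly //.
have nz_F : (fps_of_poly (C 0%N))%:F != 0 by rewrite tofrac_eq0 fps_of_poly_eq0.
apply: (mulfI nz_F); rewrite mulr0 mulrBr mulr_sumr -sumrN.
have := congr1 (@FracField.tofrac _) c_rel.
rewrite tofrac0 rmorph_sum big_ord_recl /= -CE expr1 tofracM => rel0.
rewrite -[RHS]rel0; congr (_ + _); rewrite big_add1 big_mkord.
apply: eq_bigr => i _; rewrite -CE rmorphN /= laurent_of_fracE // tofracM.
by rewrite mulNr mulrN opprK mulrA mulrCA mulfV // mulr1.
Qed.

(** * Reduction modulo p and Pochhammer symbols *)

Section Reduction.
Variable p : nat.
Hypothesis p_pr : prime p.
Implicit Types (x y : rat) (u v : 'F_p).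

(** The residue u of x in Z_(p), computed from any fraction with denominator prime to p. Not
    requiring lowest terms makes sums and products immediate. *)
Definition reduces x u : Prop := exists N D : int,
  [/\ D%:~R != 0 :> 'F_p, x = N%:~R / D%:~R & u = N%:~R / D%:~R].

Lemma intr_Fp_eq0 (D : int) : (D%:~R == 0 :> 'F_p) = (p %| `|D|)%N.
Proof. by rewrite -(dvdz_pcharf (pchar_Fp p_pr)) dvdzE. Qed.

Lemma intr_rat_neq0 (D : int) : D%:~R != 0 :> 'F_p -> D%:~R != 0 :> rat.
Proof. by rewrite intr_eq0; apply: contraNneq => ->. Qed.

Lemma reduces_zloc x u : reduces x u -> zloc p x.
Proof. by case=> N [D [nz_D -> _]]; apply: zloc_div; rewrite -intr_Fp_eq0. Qed.

Lemma reduces_redp x u : reduces x u -> redp p x = u.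
Proof.
move=> red_x; have x_loc := reduces_zloc red_x; case: red_x => N [D [nz_D Ex ->]].
have nz_d : (denq x)%:~R != 0 :> 'F_p by rewrite intr_Fp_eq0.
apply/eqP; rewrite /redp /ratr eqr_div // -!intrM; apply/eqP; congr (_ %:~R).
apply: (@intr_inj rat); rewrite !intrM; apply/eqP.
rewrite -eqr_div ?intr_eq0 ?denq_eq0 //; last by rewrite -(intr_eq0 rat) intr_rat_neq0.
by rewrite divq_num_den Ex.
Qed.

Lemma zloc_reduces x : zloc p x -> reduces x (redp p x).
Proof.
move=> x_loc; exists (numq x), (denq x).
by rewrite intr_Fp_eq0 divq_num_den.
Qed.

Lemma reduces_int (N : int) : reduces N%:~R N%:~R.
Proof. by exists N, 1; rewrite oner_eq0 !divr1. Qed.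

Lemma reduces_nat n : reduces n%:R n%:R.
Proof. exact: (reduces_int n). Qed.

Lemma reduces1 : reduces 1 1. Proof. exact: (reduces_nat 1). Qed.

Lemma reducesD x y u v : reduces x u -> reduces y v -> reduces (x + y) (u + v).
Proof.
move=> [N [D [nz_D -> ->]]] [N' [D' [nz_D' -> ->]]].
exists (N * D' + N' * D), (D * D'); rewrite !(intrD, intrM) mulf_neq0 //.
by split; rewrite // addf_div ?intr_rat_neq0.
Qed.

Lemma reducesM x y u v : reduces x u -> reduces y v -> reduces (x * y) (u * v).
Proof.
move=> [N [D [nz_D -> ->]]] [N' [D' [nz_D' -> ->]]].
exists (N * N'), (D * D'); rewrite !intrM mulf_neq0 //.
by split; rewrite // mulf_div.
Qed.

Lemma reducesV x u : u != 0 -> reduces x u -> reduces x^-1 u^-1.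
Proof.
move=> nz_u [N [D [nz_D -> Eu]]]; exists D, N; rewrite Eu !invf_div.
by split=> //; apply: contraNneq nz_u; rewrite Eu => ->; rewrite mul0r.
Qed.

Lemma reducesN x u : reduces x u -> reduces (- x) (- u).
Proof. by move=> /(reducesM (reduces_int (- 1))); rewrite !mulN1r. Qed.

Lemma reduces_eq x u v : u = v -> reduces x u -> reduces x v.
Proof. by move=> ->. Qed.

Lemma reduces_prod (I : Type) (r : seq I) (P : pred I) (F : I -> rat) (G : I -> 'F_p) :
  (forall i, P i -> reduces (F i) (G i)) ->
  reduces (\prod_(i <- r | P i) F i) (\prod_(i <- r | P i) G i).
Proof.
move=> FG; apply: (big_ind2 (fun x u => reduces x u)) => //; first exact: reduces1.
by move=> *; apply: reducesM.
Qed.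

Lemma reduces_p : reduces p%:R 0.
Proof. by have := reduces_nat p; rewrite pchar_Fp_0. Qed.

Definition padic_unit x := zloc p x && (redp p x != 0).

Lemma padic_unitP x : reflect (exists2 u, u != 0 & reduces x u) (padic_unit x).
Proof.
apply: (iffP andP) => [[x_loc nz_x]|[u nz_u red_x]].
  by exists (redp p x) => //; exact: zloc_reduces.
by split; [exact: reduces_zloc red_x | rewrite (reduces_redp red_x)].
Qed.

Lemma zlocP x : zloc p x -> {u | reduces x u}.
Proof. by move/zloc_reduces; exists (redp p x). Qed.

Lemma zlocD x y : zloc p x -> zloc p y -> zloc p (x + y).
Proof.
by move=> /zlocP[u red_x] /zlocP[v /(reducesD red_x)/reduces_zloc].
Qed.

Lemma zlocM x y : zloc p x -> zloc p y -> zloc p (x * y).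
Proof.
by move=> /zlocP[u red_x] /zlocP[v /(reducesM red_x)/reduces_zloc].
Qed.

Lemma zloc_nat n : zloc p n%:R.
Proof. exact: reduces_zloc (reduces_nat n). Qed.

Lemma padic_unit_loc x : padic_unit x -> zloc p x.
Proof. by case/andP. Qed.

Lemma padic_unit_neq0 x : padic_unit x -> x != 0.
Proof.
by apply: contraTneq => ->; rewrite /padic_unit (reduces_redp (reduces_nat 0)) eqxx andbF.
Qed.

Lemma padic_unitV x : padic_unit x -> padic_unit x^-1.
Proof.
move=> /padic_unitP[u nz_u /(reducesV nz_u) red_x]; apply/padic_unitP.
by exists u^-1; rewrite ?invr_eq0.
Qed.

Lemma padic_unitM x y : padic_unit x -> padic_unit y -> padic_unit (x * y).
Proof.
move=> /padic_unitP[u nz_u red_x] /padic_unitP[v nz_v red_y]; apply/padic_unitP.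
by exists (u * v); [rewrite mulf_neq0 | exact: reducesM].
Qed.

Lemma padic_unit_prod (I : Type) (r : seq I) (P : pred I) (F : I -> rat) :
  (forall i, P i -> padic_unit (F i)) -> padic_unit (\prod_(i <- r | P i) F i).
Proof.
move=> F_unit; elim/big_ind: _ => //; last exact: padic_unitM.
by apply/padic_unitP; exists 1; [exact: oner_neq0 | exact: reduces1].
Qed.

Lemma zloc_prod (I : Type) (r : seq I) (P : pred I) (F : I -> rat) :
  (forall i, P i -> zloc p (F i)) -> zloc p (\prod_(i <- r | P i) F i).
Proof.
move=> F_loc; elim/big_ind: _ => //; last exact: zlocM.
exact: (zloc_nat 1).
Qed.

Lemma zloc_mulr_unit x y : padic_unit y -> zloc p (x * y) = zloc p x.
Proof.
move=> y_unit; apply/idP/idP => [xy_loc|x_loc]; last by rewrite zlocM // padic_unit_loc.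
by rewrite -(mulfK (padic_unit_neq0 y_unit) x) zlocM // padic_unit_loc ?padic_unitV.
Qed.

(** If x is - rho modulo p, this is the residue of the product of the x + j with j < r, the multiple
    of p at j = rho being left out. *)
Definition wilson_prod (rho r : nat) : 'F_p :=
  \prod_(j < r | val j != rho) (j%:R - rho%:R).

Lemma natr_Fp_inj (i j : nat) : (i < p)%N -> (j < p)%N ->
  i%:R = j%:R :> 'F_p -> i = j.
Proof.
move=> lt_i lt_j /(congr1 (fun u : 'F_p => u : nat)).
by rewrite !val_Fp_nat // !modn_small.
Qed.

Lemma wilson_prodS rho r : wilson_prod rho r.+1 =
  wilson_prod rho r * (if r == rho then 1 else r%:R - rho%:R).
Proof.
rewrite /wilson_prod big_mkcond big_ord_recr -big_mkcond /=.
by case: eqP.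
Qed.

Lemma wilson_prod_neq0 rho r : (rho < p)%N -> (r <= p)%N -> wilson_prod rho r != 0.
Proof.
move=> lt_rho le_r; apply/prodf_neq0 => j ne_j; rewrite subr_eq0.
apply: contra ne_j => /eqP Ej; apply/eqP; apply: natr_Fp_inj Ej => //.
exact: leq_trans le_r.
Qed.

(** Translation by rho permutes F_p, so both sides are the product of all nonzero residues. *)
Lemma wilson_prod_full rho : (rho < p)%N -> wilson_prod rho p = wilson_prod 0 p.
Proof.
suff full r : (r < p)%N -> wilson_prod r p = \prod_(y : 'F_p | y != 0) y.
  by move=> lt_rho; rewrite !full ?prime_gt0.
move=> lt_r; rewrite /wilson_prod.
rewrite -(big_mkord (fun j => j != r) (fun j => j%:R - r%:R)).
(* The bound of the ordinal type ['F_p] equals p only propositionally. *)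
have cast m (P : pred nat) (F : nat -> 'F_p) : m = p ->
  \prod_(0 <= j < p | P j) F j = \prod_(0 <= j < m | P j) F j by move=> ->.
rewrite (cast _ _ _ (Fp_cast p_pr)) big_mkord.
rewrite [RHS](reindex_onto (fun z : 'F_p => z - r%:R)
                           (fun z : 'F_p => z + r%:R)) /=; last first.
  by move=> z _; rewrite addrK.
apply: eq_big => [j|j _]; last by rewrite natr_Zp.
rewrite subrK eqxx andbT subr_eq0; congr (~~ _).
apply/eqP/eqP => [Ej|->]; first by rewrite -[j]natr_Zp Ej.
by rewrite val_Fp_nat // modn_small.
Qed.

Lemma pochhammer0 x : pochhammer x 0 = 1.
Proof. by rewrite /pochhammer big_ord0. Qed.

Lemma pochhammerS x m : pochhammer x m.+1 = pochhammer x m * (x + m%:R).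
Proof. by rewrite /pochhammer big_ord_recr. Qed.

Lemma pochhammerSl x m : pochhammer x m.+1 = x * pochhammer (x + 1) m.
Proof.
rewrite /pochhammer big_ord_recl addr0; congr (_ * _); apply: eq_bigr => i _.
by rewrite -addrA -mulrS.
Qed.

(* The terms x + j divisible by p are the x + rho + p m = p (x' + m). *)
Lemma pochhammer_dwork x x' (rho k r : nat) :
    zloc p x' -> (rho < p)%N -> (r <= p)%N -> p%:R * x' - x = rho%:R ->
  exists2 U, reduces U (wilson_prod 0 p ^+ k * wilson_prod rho r) &
    pochhammer x (p * k + r) =
      p%:R ^+ (k + (rho < r)) * pochhammer x' (k + (rho < r)) * U.
Proof.
move=> x'_loc lt_rho le_r Ex.
have Ex' : x = p%:R * x' - rho%:R by rewrite -Ex subKr.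
have red_x : reduces x (- rho%:R).
  rewrite Ex' -[- _ : 'F_p]add0r -{1}[0](mul0r (redp p x')).
  by apply: reducesD; [apply: reducesM (zloc_reduces _) => //; exact: reduces_p
    | apply/reducesN/reduces_nat].
(* One more factor: at r0 = rho it is p (x' + k0) and goes to the Pochhammer symbol of x'; otherwise
   it is a unit and goes to U. *)
have step k0 r0 : (r0 < p)%N ->
    (exists2 U, reduces U (wilson_prod 0 p ^+ k0 * wilson_prod rho r0) &
      pochhammer x (p * k0 + r0) =
      p%:R ^+ (k0 + (rho < r0)) * pochhammer x' (k0 + (rho < r0)) * U) ->
    exists2 U, reduces U (wilson_prod 0 p ^+ k0 * wilson_prod rho r0.+1) &
      pochhammer x (p * k0 + r0.+1) =
      p%:R ^+ (k0 + (rho < r0.+1)) * pochhammer x' (k0 + (rho < r0.+1)) * U.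
  move=> lt_r0 [U red_U EU]; rewrite addnS pochhammerS EU {EU}.
  rewrite wilson_prodS.
  have [Er|ne_r] := eqVneq r0 rho.
    exists U; first by rewrite mulr1.
    rewrite Er ltnn ltnSn addn0 addn1 pochhammerS exprS Ex' !natrD natrM; ring.
  exists (U * (x + (p * k0 + r0)%:R)).
    rewrite mulrA; apply: reducesM red_U _; apply: reduces_eq (reducesD red_x (reduces_nat _)).
    by rewrite natrD natrM pchar_Fp_0 // mul0r add0r addrC.
  by rewrite (_ : (rho < r0.+1)%N = (rho < r0)%N) ?mulrA //; lia.
elim: k r le_r => [|k IHk]; elim=> [|r IHr] lt_rp; try exact/step/IHr/ltnW.
  exists 1; last by rewrite muln0 !pochhammer0 expr0 !mulr1.
  by rewrite expr0 mul1r /wilson_prod big_ord0; exact: reduces1.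
(* A complete block of p factors contributes a residue that does not depend on rho. *)
have [U red_U EU] := IHk p (leqnn p).
exists U; last by move: EU; rewrite lt_rho addn0 ltn0 addn1 addn0 mulnS addnC.
by rewrite exprSr -{2}(wilson_prod_full lt_rho) [X in _ * X]big_ord0 mulr1.
Qed.

End Reduction.

(** * The Dwork map on small rational numbers *)

Section DworkParameters.
Variables p d : nat.
Hypotheses (p_pr : prime p) (d_gt0 : (0 < d)%N) (lt_dp : (d < p)%N).
Implicit Types x y z : rat.

(** The integrality condition says that the denominator of x divides d. This class is stable under
    the Dwork map ([param_dwork]). *)
Definition param x := (0 < x <= 1) && (d%:R * x \is a Num.int).

Let nz_d : d%:R != 0 :> rat. Proof. by rewrite pnatr_eq0 -lt0n. Qed.
Let nz_p : p%:R != 0 :> rat. Proof. by rewrite pnatr_eq0 -lt0n prime_gt0. Qed.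

(** Here z = m / d with 0 < |m| <= d < p, so p divides neither m nor d. *)
Lemma small_padic_unit z : d%:R * z \is a Num.int -> z != 0 -> `|z| <= 1 ->
  padic_unit p z.
Proof.
move=> /intrP[m Em] nz_z le_z1.
have Ez : z = m%:~R / d%:R by rewrite -Em mulrC mulKf.
have d_unit : (d%:Z%:~R : 'F_p) != 0 by rewrite intr_Fp_eq0 // gtnNdvd.
have m_unit : (m%:~R : 'F_p) != 0.
  have nz_m : m != 0 by apply: contraNneq nz_z => m0; rewrite Ez m0 mul0r.
  rewrite intr_Fp_eq0 // gtnNdvd ?absz_gt0 //.
  apply: leq_ltn_trans lt_dp; rewrite -(ler_nat rat) natr_absz intr_norm -Em normrM.
  by rewrite normr_nat ler_piMr.
apply/(padic_unitP p_pr); exists (m%:~R / (d%:Z)%:~R); last by exists m, d%:Z.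
by rewrite mulf_neq0 ?invr_eq0.
Qed.

Lemma param_unit x : param x -> padic_unit p x.
Proof.
move=> /andP[/andP[x_gt0 x_le1] x_int]; apply: small_padic_unit => //.
  by rewrite gt_eqF.
by rewrite gtr0_norm.
Qed.

Lemma param_sub_unit x y : param x -> param y -> x != y -> padic_unit p (x - y).
Proof.
move=> /andP[/andP[x_gt0 x_le1] x_int] /andP[/andP[y_gt0 y_le1] y_int] ne_xy.
apply: small_padic_unit; rewrite ?subr_eq0 // ?mulrBr ?rpredB //.
by rewrite ler_norml; apply/andP; split; lra.
Qed.

(** For x in Z_(p), the digit rho = p D(x) - x as a natural number: the first j for which x + j is
    divisible by p. *)
Definition thresh x : nat := `|numq (p%:R * dwork p x - x)|%N.

Lemma threshP x : zloc p x ->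
  (thresh x < p)%N /\ p%:R * dwork p x - x = (thresh x)%:R.
Proof.
move=> /(dworkP p_pr)[_ [r lt_r Er]]; rewrite /thresh Er.
by rewrite (numq_int r) absz_nat.
Qed.

Lemma param_loc x : param x -> zloc p x.
Proof. by move/param_unit/padic_unit_loc. Qed.

Lemma dwork_loc x : param x -> zloc p (dwork p x).
Proof. by move=> /param_loc/(dworkP p_pr)[]. Qed.

(** D(x) = (x + rho) / p with 0 <= rho <= p - 1 lies in (0,1]. Its denominator divides p d and is
    prime to p, hence divides d. *)
Lemma param_dwork x : param x -> param (dwork p x).
Proof.
move=> x_par; have [lt_t Et] := threshP (param_loc x_par).
have y_loc := dwork_loc x_par; move: (dwork p x) y_loc Et => y y_loc Et.
have /andP[/andP[x_gt0 x_le1] /intrP[m Em]] := x_par.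
have p_gt0 : 0 < p%:R :> rat by rewrite ltr0n prime_gt0.
have Ey : p%:R * y = x + (thresh x)%:R by rewrite -Et addrC subrK.
have t_ge0 : 0 <= (thresh x)%:R :> rat by rewrite ler0n.
have t_le : (thresh x)%:R + 1 <= p%:R :> rat by rewrite natr1 ler_nat.
apply/andP; split.
  apply/andP; split; first by rewrite -(pmulr_rgt0 _ p_gt0); lra.
  by rewrite -(ler_pM2l p_gt0); lra.
have nz_D : (denq y)%:~R != 0 :> rat by rewrite intr_eq0 denq_eq0.
have E : (p%:Z * (d%:Z * numq y) = (m + d%:Z * (thresh x)%:Z) * denq y)%R.
  apply: (@intr_inj rat); rewrite !(intrM, intrD) -Em -!pmulrn.
  rewrite -[X in _ * _ = X * _]mulrDr -Ey.
  by rewrite -{2}(divq_num_den y) mulrCA !mulrA divfK // [d%:R * _]mulrC.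
have : (denq y %| p%:Z * (d%:Z * numq y))%Z by rewrite E dvdz_mull.
rewrite Gauss_dvdzr; last first.
  by rewrite coprimezE coprime_sym prime_coprime.
rewrite Gauss_dvdzl; last by rewrite coprimezE coprime_sym coprime_num_den.
move=> /dvdzP[c Ec]; rewrite pmulrn Ec intrM -mulrA [_ * y]mulrC -numqE.
by rewrite -intrM intr_int.
Qed.

(** Otherwise x = p D(x) would not be a unit. Thus lowering a threshold by one is never
    truncated. *)
Lemma thresh_gt0 x : param x -> (0 < thresh x)%N.
Proof.
move=> x_par; have [_ Et] := threshP (param_loc x_par).
rewrite lt0n; apply/eqP => t0; have /andP[_] := param_unit x_par.
suff /(reduces_redp p_pr)-> : reduces (p := p) x 0 by rewrite eqxx.
have -> : x = p%:R * dwork p x by apply/eqP; rewrite eq_sym -subr_eq0 Et t0.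
apply: (reduces_eq (mul0r (redp p (dwork p x)))).
by apply: reducesM; [exact: reduces_p | apply/zloc_reduces/dwork_loc].
Qed.

(** Equal thresholds would make x - y = p (D(x) - D(y)), whereas x - y is a unit. *)
Lemma thresh_neq x y : param x -> param y -> x != y -> thresh x != thresh y.
Proof.
move=> x_par y_par ne_xy; apply/eqP => E.
have [_ Ex] := threshP (param_loc x_par); have [_ Ey] := threshP (param_loc y_par).
have /andP[_] := param_sub_unit x_par y_par ne_xy.
suff /(reduces_redp p_pr)-> : reduces (p := p) (x - y) 0 by rewrite eqxx.
have -> : x - y = p%:R * (dwork p x - dwork p y).
  by move: Ey; rewrite -E -Ex mulrBr => Exy; apply/eqP; rewrite -subr_eq0; apply/eqP; lra.
apply: (reduces_eq (mul0r (redp p (dwork p x) - redp p (dwork p y)))).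
apply: reducesM; first exact: reduces_p.
by apply: reducesD; [|apply: reducesN]; apply/zloc_reduces/dwork_loc.
Qed.

(** If the images agree, x - y is a difference of two thresholds, an integer of absolute value less
    than 1. *)
Lemma dwork_neq x y : param x -> param y -> x != y -> dwork p x != dwork p y.
Proof.
move=> x_par y_par; apply: contra => /eqP E.
have [_ Ex] := threshP (param_loc x_par); have [_ Ey] := threshP (param_loc y_par).
have /andP[/andP[x_gt0 x_le1] _] := x_par; have /andP[/andP[y_gt0 y_le1] _] := y_par.
have Exy : x - y = ((thresh y)%:Z - (thresh x)%:Z)%:~R.
  by rewrite intrB -!pmulrn -Ex -Ey E; ring.
have : `|x - y| < 1 by rewrite ltr_norml; apply/andP; split; lra.
rewrite Exy -intr_norm -[1]/(1%:~R) ltr_int -subr_eq0 Exy => lt1.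
by rewrite intr_eq0; apply/eqP; lia.
Qed.

Lemma dwork1 : dwork p 1 = 1.
Proof.
apply: (@dwork_unique p 1 1 p.-1) => //; rewrite ?(zloc_nat p_pr 1) //.
  by rewrite ltn_predL prime_gt0.
by rewrite mulr1 -{1}(prednK (prime_gt0 p_pr)) -natr1 addrK.
Qed.

Lemma thresh1 : thresh 1 = p.-1.
Proof.
have := congr1 (fun z => `|numq z|%N) (threshP (zloc_nat p_pr 1)).2.
rewrite /= (numq_int (thresh 1)) absz_nat => <-; rewrite dwork1 mulr1.
by rewrite -{1}(prednK (prime_gt0 p_pr)) -natr1 addrK (numq_int p.-1).
Qed.

Lemma dwork_iter_int x m : param x ->
  param (iter m (dwork p) x) /\
  exists r : nat, (p ^ m)%:R * iter m (dwork p) x - x = r%:R.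
Proof.
move=> x_par; elim: m => [|m [par_m [r Er]]].
  by split=> //; exists 0%N; rewrite mul1r subrr.
split; first exact: param_dwork.
have [_ Et] := threshP (param_loc par_m).
exists (p ^ m * thresh (iter m (dwork p) x) + r)%N.
by rewrite natrD natrM -Et -Er expnSr natrM /=; ring.
Qed.

(** Put m = d x and M = d D^l(x). As p^l M - m is a multiple of d, M and m are congruent modulo d,
    and both lie between 1 and d. *)
Lemma dwork_period x l : (p ^ l = 1 %[mod d])%N -> param x ->
  iter l (dwork p) x = x.
Proof.
move=> pl1 x_par; have [y_par [r Er]] := dwork_iter_int l x_par.
move: (iter _ _ _) y_par Er => y /andP[/andP[y_gt0 y_le1] /intrP[M EM]] Er.
have /andP[/andP[x_gt0 x_le1] /intrP[m Em]] := x_par.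
have d_pos : 0 < d%:R :> rat by rewrite ltr0n.
have bound z (k : int) : 0 < z -> z <= 1 -> d%:R * z = k%:~R -> 0 < k <= d.
  move=> z_gt0 z_le1 Ek; rewrite -(ltr0z rat) -(ler_int rat) -Ek.
  by rewrite mulr_gt0 //= ler_piMr // ltW.
have /andP[m_gt0 m_le] := bound _ _ x_gt0 x_le1 Em.
have /andP[M_gt0 M_le] := bound _ _ y_gt0 y_le1 EM.
have E : ((p ^ l)%N%:Z * M - m = d%:Z * r%:Z)%R.
  apply: (@intr_inj rat); rewrite intrB !intrM -Em -EM -!pmulrn -Er; ring.
have [c Ec] : exists c : int, ((p ^ l)%N%:Z = 1 + c * d%:Z)%R.
  have pl_gt0 : (0 < p ^ l)%N by rewrite expn_gt0 prime_gt0.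
  move/eqP: pl1; rewrite eqn_mod_dvd // => /dvdnP[c Ec].
  by exists c; rewrite -PoszM -Ec -PoszD subnKC.
have EMm : (M - m = d%:Z * (r%:Z - c * M))%R.
  rewrite mulrBr -E Ec; ring.
have M_m : M = m.
  move: (r%:Z - c * M)%R EMm => k EMm; have [k_lt|k_gt|k0] := ltrgtP k 0.
  - have : (d%:Z * k <= d%:Z * (-1))%R by rewrite ler_wpM2l //; lia.
    move: EMm; lia.
  - have : (d%:Z * 1 <= d%:Z * k)%R by rewrite ler_wpM2l //; lia.
    move: EMm; lia.
  by move: EMm; rewrite k0 mulr0; lia.
by apply: (mulfI nz_d); rewrite EM M_m Em.
Qed.

End DworkParameters.

(** * Contiguous hypergeometric coefficients *)

Section Contiguous.
Variables (p d n : nat).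
Hypotheses (p_pr : prime p) (d_gt0 : (0 < d)%N) (lt_dp : (d < p)%N).
Implicit Types (a b : 'I_n -> rat) (A B : {set 'I_n}) (x : rat).

(** Coefficients of a contiguous series: A and B mark the parameters raised by 1. The denominator
    runs over the full tuple b, whose entry 1 accounts for the factorial. *)
Definition hypQ a b A B k : rat :=
  (\prod_i pochhammer (a i + (i \in A)%:R) k) /
  (\prod_i pochhammer (b i + (i \in B)%:R) k).

(* The indices i for which some (a_i + [i in A]) + j with j < r is divisible
   by p. *)
Definition crossed a A r : {set 'I_n} :=
  [set i | (thresh p (a i) - (i \in A) < r)%N].

Let nz_p : p%:R != 0 :> rat. Proof. by rewrite pnatr_eq0 -lt0n prime_gt0. Qed.

Lemma pochhammer_shift x k (c : bool) :
  pochhammer x (k + c) = pochhammer (x + c%:R) k * (if c then x else 1).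
Proof.
case: c; last by rewrite addn0 addr0 mulr1.
by rewrite addn1 pochhammerSl mulrC.
Qed.

(** The dependence of the residue on k is confined to a factor that involves only k and n, so it
    cancels between numerator and denominator in [hypQ_dwork]. *)
Lemma prod_pochhammer_dwork a A r : (forall i, param d (a i)) -> (r <= p)%N ->
  exists2 v : 'F_p, v != 0 & forall k, exists2 V,
    reduces V (wilson_prod p 0 p ^+ (k * n) * v) &
    \prod_i pochhammer (a i + (i \in A)%:R) (p * k + r) =
    p%:R ^+ (k * n) * p%:R ^+ #|crossed a A r| *
    \prod_i pochhammer (dwork p (a i) + (i \in crossed a A r)%:R) k * V.
Proof.
move=> a_par le_r; pose rho i := (thresh p (a i) - (i \in A))%N.
have t_gt0 i : (0 < thresh p (a i))%N by apply: (thresh_gt0 p_pr d_gt0 lt_dp).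
have tP i := threshP p_pr (param_loc p_pr d_gt0 lt_dp (a_par i)).
have lt_rho i : (rho i < p)%N by apply: leq_ltn_trans (leq_subr _ _) (tP i).1.
have a'_loc i : zloc p (dwork p (a i)) by apply: (dwork_loc p_pr d_gt0 lt_dp).
(* Raising a_i by 1 keeps its Dwork image and lowers its threshold by 1. *)
have Erho i : p%:R * dwork p (a i) - (a i + (i \in A)%:R) = (rho i)%:R.
  rewrite opprD addrA (tP i).2 /rho natrB //.
  by apply: leq_trans (t_gt0 i); case: (i \in A).
(* For a crossed index, trading the extra Pochhammer factor for a shift of the parameter leaves the
   unit D(a_i). *)
exists (\prod_i (wilson_prod p (rho i) r *
          redp p (if i \in crossed a A r then dwork p (a i) else 1))).
  apply/prodf_neq0 => i _; rewrite mulf_neq0 ?wilson_prod_neq0 //.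
  case: ifP => _; last by rewrite (reduces_redp p_pr (reduces1 p)) oner_eq0.
  by have /andP[] := param_unit p_pr d_gt0 lt_dp (param_dwork p_pr d_gt0 lt_dp (a_par i)).
move=> k.
have /choice[U UP] : forall i, exists U,
    reduces U (wilson_prod p 0 p ^+ k * wilson_prod p (rho i) r) /\
    pochhammer (a i + (i \in A)%:R) (p * k + r) =
    p%:R ^+ (k + (rho i < r)) * pochhammer (dwork p (a i)) (k + (rho i < r)) * U.
  move=> i.
  by have [U ? ?] := pochhammer_dwork p_pr k (a'_loc i) (lt_rho i) le_r (Erho i); exists U.
exists (\prod_i (U i * (if i \in crossed a A r then dwork p (a i) else 1))).
  apply: (@reduces_eq _ _ (\prod_i (wilson_prod p 0 p ^+ k * wilson_prod p (rho i) r *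
       redp p (if i \in crossed a A r then dwork p (a i) else 1)))).
    rewrite (eq_bigr _ (fun i _ => esym (mulrA _ _ _))) big_split /=.
    by rewrite prodr_const card_ord exprM.
  apply: reduces_prod => i _; apply: reducesM; first exact: (UP i).1.
  by apply: zloc_reduces => //; case: ifP => // _; exact: (zloc_nat p_pr 1).
have Ecr i : (rho i < r)%N = (i \in crossed a A r) by rewrite inE.
rewrite (eq_bigr (fun i => p%:R ^+ k * p%:R ^+ (i \in crossed a A r) *
   (pochhammer (dwork p (a i) + (i \in crossed a A r)%:R) k *
   (U i * (if i \in crossed a A r then dwork p (a i) else 1))))); last first.
  by move=> i _; rewrite (UP i).2 Ecr exprD pochhammer_shift -!mulrA [_ * U i]mulrC.
rewrite !big_split /= prodr_const card_ord -exprM -!mulrA; congr (_ * (_ * _)).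
by rewrite prodrXr -sum1_card [in RHS]big_mkcond; congr (_ ^+ _).
Qed.

Lemma hypQ_dwork a b A B r :
    (forall i, param d (a i)) -> (forall i, param d (b i)) -> (r <= p)%N ->
  exists2 v : 'F_p, v != 0 & forall k, exists2 V, reduces V v &
    hypQ a b A B (p * k + r) =
    p%:R ^+ #|crossed a A r| / p%:R ^+ #|crossed b B r| *
    hypQ (fun i => dwork p (a i)) (fun i => dwork p (b i))
         (crossed a A r) (crossed b B r) k * V.
Proof.
move=> a_par b_par le_r.
have [v nz_v Hv] := prod_pochhammer_dwork A a_par le_r.
have [w nz_w Hw] := prod_pochhammer_dwork B b_par le_r.
exists (v / w); first by rewrite mulf_neq0 ?invr_eq0.
move=> k; have [V red_V EV] := Hv k; have [W red_W EW] := Hw k.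
have nz_c : wilson_prod p 0 p ^+ (k * n) != 0.
  by rewrite expf_neq0 // wilson_prod_neq0 ?prime_gt0.
exists (V / W).
  apply: reduces_eq (reducesM red_V (reducesV _ red_W)).
    by rewrite -mulf_div divff // mul1r.
  by rewrite mulf_neq0.
by rewrite /hypQ EV EW -!mulf_div divff ?mul1r ?expf_neq0.
Qed.

End Contiguous.

(** * Decomposition modulo p *)

Section Admissible.
Variables (p d n : nat) (j0 : 'I_n).
Hypotheses (p_pr : prime p) (d_gt0 : (0 < d)%N) (lt_dp : (d < p)%N).
Implicit Types (a b : 'I_n -> rat) (A B : {set 'I_n}) (x : rat).

(** The conditions on the parameters that the Dwork map preserves ([admissible_dwork]); [adm_loc] is
    the integrality of the series. *)
Record admissible a b : Prop := Admissible {
  adm_a : forall i, param d (a i);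
  adm_b : forall i, param d (b i);
  adm_neq : forall i j, a i != b j;
  adm_one : b j0 = 1;
  adm_loc : forall k, zloc p (hypQ a b set0 set0 k) }.

Lemma param_gt0 x : param d x -> 0 < x.
Proof. by case/andP=> /andP[]. Qed.

Lemma prod_pochhammer_contiguous a A k : (forall i, param d (a i)) ->
  \prod_i pochhammer (a i + (i \in A)%:R) k =
  (\prod_i pochhammer (a i) k) *
  \prod_i (if i \in A then (a i + k%:R) / a i else 1).
Proof.
move=> a_par; rewrite -big_split /=; apply: eq_bigr => i _.
have nz_a : a i != 0 by rewrite gt_eqF ?param_gt0.
have := pochhammer_shift (a i) k (i \in A); case: (i \in A) => /=.
  by rewrite addn1 pochhammerS mulrA => ->; rewrite mulfK.
by rewrite addr0 !mulr1.
Qed.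

Lemma hypQ0E a b k : hypQ a b set0 set0 k =
  (\prod_i pochhammer (a i) k) / (\prod_i pochhammer (b i) k).
Proof. by congr (_ / _); apply: eq_bigr => i _; rewrite inE addr0. Qed.

(** The coefficient is Q(k) times factors (a_i + k) / a_i for i in A and b_i / (b_i + k) for i in B.
    If some b_j + k is not a unit, all a_i + k are, and integrality of Q(k+1) absorbs the
    denominators. *)
Lemma zloc_hypQ a b A B k : admissible a b -> zloc p (hypQ a b A B k).
Proof.
move=> ab; have a_par := adm_a ab; have b_par := adm_b ab.
rewrite /hypQ !prod_pochhammer_contiguous // -mulf_div -hypQ0E.
have a_unit i := param_unit p_pr d_gt0 lt_dp (a_par i).
have b_unit i := param_unit p_pr d_gt0 lt_dp (b_par i).
have a_loc i : zloc p (a i + k%:R).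
  by rewrite (zlocD p_pr) ?(zloc_nat p_pr) ?padic_unit_loc.
have b_loc i : zloc p (b i + k%:R).
  by rewrite (zlocD p_pr) ?(zloc_nat p_pr) ?padic_unit_loc.
have unit1 : padic_unit p 1.
  by apply/(padic_unitP p_pr); exists 1; [rewrite oner_eq0 | exact: reduces1].
have num_loc : zloc p (\prod_i (if i \in A then (a i + k%:R) / a i else 1)).
  apply: (zloc_prod p_pr) => i _; case: ifP => _; last exact: padic_unit_loc.
  by rewrite (zlocM p_pr) // padic_unit_loc ?(padic_unitV p_pr).
have [/forallP all_unit | ] := boolP [forall j, padic_unit p (b j + k%:R)].
  rewrite (zlocM p_pr) ?(adm_loc ab) // (zlocM p_pr) // padic_unit_loc //.
  rewrite (padic_unitV p_pr) // (padic_unit_prod p_pr) // => j _.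
  by case: ifP => // _; rewrite (padic_unitM p_pr) ?(padic_unitV p_pr).
rewrite negb_forall => /existsP[j nunit_j].
have a_unit' i : padic_unit p (a i + k%:R).
  have /(padic_unitP p_pr)[u nz_u red_u] :=
    param_sub_unit p_pr d_gt0 lt_dp (a_par i) (b_par j) (adm_neq ab i j).
  apply/(padic_unitP p_pr); exists u => //.
  have -> : a i + k%:R = (a i - b j) + (b j + k%:R) by ring.
  apply: reduces_eq (addr0 u) (reducesD red_u _).
  move: nunit_j; rewrite /padic_unit b_loc negbK => /eqP <-.
  exact: zloc_reduces.
rewrite [_ / _]mulrC mulrA (zlocM p_pr) //.
have nz_b i : b i + k%:R != 0.
  by rewrite gt_eqF // ltr_wpDr ?ler0n ?param_gt0.
(* The denominator is completed to the product over all i, to match the step from k to k + 1. *)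
have -> : (\prod_i (if i \in B then (b i + k%:R) / b i else 1))^-1 =
    (\prod_i (b i + k%:R))^-1 * \prod_i (if i \in B then b i else b i + k%:R).
  rewrite -!prodfV -big_split; apply: eq_bigr => i _ /=.
  by case: ifP => _; rewrite ?invf_div ?mulVf ?invr1 // mulrC.
rewrite mulrA (zlocM p_pr) //; last first.
  by apply: (zloc_prod p_pr) => i _; case: ifP => _ //; exact: padic_unit_loc.
have -> : hypQ a b set0 set0 k / \prod_i (b i + k%:R) =
    hypQ a b set0 set0 k.+1 / \prod_i (a i + k%:R).
  have pS c : \prod_(i < n) pochhammer (c i) k.+1 =
      (\prod_i pochhammer (c i) k) * \prod_i (c i + k%:R).
    by rewrite -big_split; apply: eq_bigr => i _; rewrite pochhammerS.
  have cancel (x y u v : rat) : u != 0 -> x / y / v = x * u / (y * v) / u.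
    by move=> nz_u; rewrite -[in RHS]mulf_div -[RHS]mulrA [u / v]mulrC mulfK.
  rewrite !hypQ0E !pS -cancel //; apply/prodf_neq0 => i _.
  exact: padic_unit_neq0 (a_unit' i).
rewrite (zlocM p_pr) ?(adm_loc ab) // padic_unit_loc // (padic_unitV p_pr) //.
exact: padic_unit_prod.
Qed.

Lemma crossed0 a A : crossed p a A 0 = set0.
Proof. by apply/setP => i; rewrite !inE ltn0. Qed.

Lemma hypQ_at0 a b A B : hypQ a b A B 0 = 1.
Proof. by rewrite /hypQ !big1 ?divr1 // => i _; rewrite pochhammer0. Qed.

(** Integrality passes to the image because nothing is crossed at r = 0: the coefficient at p k is a
    unit times the image coefficient at k. *)
Lemma admissible_dwork a b : admissible a b ->
  admissible (fun i => dwork p (a i)) (fun i => dwork p (b i)).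
Proof.
move=> ab; have a_par := adm_a ab; have b_par := adm_b ab; split.
- by move=> i; exact: (param_dwork p_pr).
- by move=> i; exact: (param_dwork p_pr).
- by move=> i j; apply: (dwork_neq p_pr d_gt0 lt_dp) => //; exact: (adm_neq ab).
- by rewrite (adm_one ab) (dwork1 p_pr).
move=> k; have [v nz_v Hv] :=
  hypQ_dwork p_pr d_gt0 lt_dp set0 set0 a_par b_par (leq0n p).
have [V red_V] := Hv k; rewrite !crossed0 cards0 divr1 mul1r => EV.
have V_unit : padic_unit p V by apply/(padic_unitP p_pr); exists v.
by rewrite -(zloc_mulr_unit p_pr _ V_unit) -EV (adm_loc ab).
Qed.

(** The coefficient at r is a unit times p to the difference of the two cardinals, and it is
    integral. *)
Lemma card_crossed a b A B r : admissible a b -> (r <= p)%N ->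
  (#|crossed p b B r| <= #|crossed p a A r|)%N.
Proof.
move=> ab le_r; have [v nz_v Hv] :=
  hypQ_dwork p_pr d_gt0 lt_dp A B (adm_a ab) (adm_b ab) le_r.
have [V red_V] := Hv 0%N; rewrite hypQ_at0 muln0 add0n mulr1 => EV.
have nz_p : p%:R != 0 :> rat by rewrite pnatr_eq0 -lt0n prime_gt0.
rewrite leqNgt; apply: contra nz_v => lt_AB.
rewrite -(reduces_redp p_pr red_V); apply/eqP/(reduces_redp p_pr).
have [c Ec] : exists c, #|crossed p b B r| = (#|crossed p a A r| + c.+1)%N.
  by exists (#|crossed p b B r| - #|crossed p a A r|.+1)%N; rewrite addnS -addSn subnKC.
have -> : V = hypQ a b A B r * p%:R ^+ c * p%:R.
  have cancel (x y z w : rat) : x != 0 -> y != 0 -> z != 0 ->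
    w = x / (x * (y * z)) * w * y * z by move=> *; field; do ?[apply/and3P; split].
  by rewrite EV Ec exprD exprSr -cancel ?expf_neq0.
apply: reduces_eq (mulr0 _) (reducesM (zloc_reduces p_pr _) (reduces_p p_pr)).
by rewrite (zlocM p_pr) ?zloc_hypQ // -natrX (zloc_nat p_pr).
Qed.

Lemma redp_hypQ a b A B r : admissible a b -> (r < p)%N ->
  exists v : 'F_p, forall k, redp p (hypQ a b A B (p * k + r)) =
    if #|crossed p a A r| == #|crossed p b B r|
    then v * redp p (hypQ (fun i => dwork p (a i)) (fun i => dwork p (b i))
                          (crossed p a A r) (crossed p b B r) k)
    else 0.
Proof.
move=> ab lt_r; have [v _ Hv] :=
  hypQ_dwork p_pr d_gt0 lt_dp A B (adm_a ab) (adm_b ab) (ltnW lt_r).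
exists v => k; have [V red_V ->] := Hv k.
have le_c := card_crossed A B ab (ltnW lt_r).
have nz_p : p%:R != 0 :> rat by rewrite pnatr_eq0 -lt0n prime_gt0.
have Q_loc : zloc p (hypQ (fun i => dwork p (a i)) (fun i => dwork p (b i))
                          (crossed p a A r) (crossed p b B r) k).
  by rewrite zloc_hypQ //; exact: admissible_dwork.
move: (hypQ _ _ _ _ _) Q_loc => H H_loc.
case: eqP => [-> | ne_c].
  rewrite divff ?expf_neq0 // mul1r mulrC; apply: (reduces_redp p_pr).
  by apply: reducesM red_V (zloc_reduces p_pr _).
apply: (reduces_redp p_pr).
have [c ->] : exists c, #|crossed p a A r| = (#|crossed p b B r| + c.+1)%N.
  by exists (#|crossed p a A r| - #|crossed p b B r|.+1)%N; lia.
rewrite exprD [_ * p%:R ^+ c.+1]mulrC mulfK ?expf_neq0 // exprS -!mulrA.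
apply: reduces_eq (mul0r _) (reducesM (reduces_p p_pr) (zloc_reduces p_pr _)).
rewrite (zlocM p_pr) -?natrX ?(zloc_nat p_pr) // (zlocM p_pr) //.
exact: reduces_zloc red_V.
Qed.

(** The pairs of shifts that survive modulo p. They are read off the unshifted parameters; shifted
    ones add no new pair ([crossing_types_shift]). *)
Definition crossing_types a b : {set {set 'I_n} * {set 'I_n}} :=
  [set (crossed p a set0 r, crossed p b set0 r) |
    r : 'I_p & #|crossed p a set0 r| == #|crossed p b set0 r|].

Lemma crossing_types0 a b : (set0, set0) \in crossing_types a b.
Proof.
apply/imsetP; exists (Ordinal (prime_gt0 p_pr)); by rewrite ?inE /= !crossed0.
Qed.

(** The threshold of 1 is p - 1, which is never less than an r < p. *)
Lemma crossing_types_one a b (t : {set 'I_n} * {set 'I_n}) :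
  admissible a b -> t \in crossing_types a b -> j0 \notin t.2.
Proof.
move=> ab /imsetP[r _ ->]; rewrite !inE (adm_one ab) (thresh1 p_pr) subn0.
by have := ltn_ord r; lia.
Qed.

Lemma crossed_shift a A r i : (forall i, param d (a i)) ->
  thresh p (a i) != r -> (i \in crossed p a A r) = (thresh p (a i) < r)%N.
Proof.
move=> a_par; rewrite inE.
have := thresh_gt0 p_pr d_gt0 lt_dp (a_par i); case: (i \in A); lia.
Qed.

(* Shifting moves some thresholds from rho to rho - 1.  No threshold of a is one
   of b, so at a given r only one of the two sets can change, and integrality
   (card_crossed) then determines it. *)
Lemma crossing_types_shift a b A B r : admissible a b -> j0 \notin B ->
    (r < p)%N -> #|crossed p a A r| = #|crossed p b B r| ->
  (crossed p a A r, crossed p b B r) \in crossing_types a b.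
Proof.
move=> ab B'j0 lt_r Ecard; have a_par := adm_a ab; have b_par := adm_b ab.
have [/existsP[j /eqP Ej] | /existsPn none] :=
  boolP [exists j, thresh p (b j) == r].
  have ne_a i : thresh p (a i) != r.
    by rewrite -Ej (thresh_neq p_pr d_gt0 lt_dp) // (adm_neq ab).
  have EA : crossed p a A r = crossed p a set0 r.+1.
    apply/setP => i; rewrite crossed_shift // !inE subn0 ltnS.
    by rewrite ltn_neqAle ne_a.
  (* Inclusion is clear; the cardinals agree by [card_crossed] at r + 1. *)
  have EB : crossed p b B r = crossed p b set0 r.+1.
    apply/eqP; rewrite eqEcard -Ecard EA card_crossed // andbT.
    apply/subsetP => i; rewrite !inE; case: (i \in B); lia.
  (* If r + 1 = p, the index j0 would be crossed at r, although its threshold p - 1 is not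
     lowered. *)
  have lt_r1 : (r.+1 < p)%N.
    rewrite ltn_neqAle lt_r andbT; apply/eqP => Er.
    have : j0 \in crossed p b B r.
      by rewrite EB !inE subn0 (adm_one ab) (thresh1 p_pr); lia.
    by rewrite inE (negPf B'j0) subn0 (adm_one ab) (thresh1 p_pr); lia.
  apply/imsetP; exists (Ordinal lt_r1); last by rewrite /= EA EB.
  by rewrite inE /= -EA -EB Ecard.
have EB : crossed p b B r = crossed p b set0 r.
  by apply/setP => i; rewrite !crossed_shift.
have EA : crossed p a A r = crossed p a set0 r.
  apply/esym/eqP; rewrite eqEcard Ecard EB card_crossed ?(ltnW lt_r) // andbT.
  by apply/subsetP => i; rewrite !inE; case: (i \in A); lia.
apply/imsetP; exists (Ordinal lt_r); last by rewrite /= EA EB.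
by rewrite inE /= -EA -EB Ecard.
Qed.

Definition hyp_fps a b (t : {set 'I_n} * {set 'I_n}) : fps 'F_p :=
  Fps (fun k => redp p (hypQ a b t.1 t.2 k)).

(** Each section at r < p is zero or a constant v_r times one image series. So P_s collects the v_r
    z^r over the r of type s. *)
Lemma hyp_fps_dwork a b (t : {set 'I_n} * {set 'I_n}) : admissible a b -> j0 \notin t.2 ->
  exists2 P : {set 'I_n} * {set 'I_n} -> {poly 'F_p},
    forall s, (size (P s) <= p)%N &
    hyp_fps a b t = \sum_(s in crossing_types a b) fps_of_poly (P s) *
      hyp_fps (fun i => dwork p (a i)) (fun i => dwork p (b i)) s ^+ p.
Proof.
case: t => A B /= ab B'j0.
have /choice[v Hv] : forall r : 'I_p, exists v : 'F_p, forall k,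
    redp p (hypQ a b A B (p * k + r)) =
    if #|crossed p a A r| == #|crossed p b B r|
    then v * redp p (hypQ (fun i => dwork p (a i)) (fun i => dwork p (b i))
                          (crossed p a A r) (crossed p b B r) k)
    else 0.
  by move=> r; exact: redp_hypQ.
pose u s (r : 'I_p) := if (#|crossed p a A r| == #|crossed p b B r|) &&
  (s == (crossed p a A r, crossed p b B r)) then v r else 0.
pose P s : {poly 'F_p} := \poly_(r < p) (if insub r is Some r' then u s r' else 0).
exists P; first by move=> s; exact: size_poly.
apply: (fps_section_inj (prime_gt0 p_pr)) => r lt_rp.
rewrite fps_section_sum; apply: fpsP => k; rewrite fcoef_sum.
pose g := hyp_fps (fun i => dwork p (a i)) (fun i => dwork p (b i)).
rewrite (eq_bigr (fun s => u s (Ordinal lt_rp) * fcoef (g s) k)); last first.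
  move=> s _; rewrite fps_exp_pchar // fps_section_mul_subst //.
  rewrite fps_section_poly // ?size_poly // fcoef_polyC_mul coef_poly lt_rp.
  by rewrite (insubT (fun r => (r < p)%N) lt_rp).
rewrite [LHS](Hv (Ordinal lt_rp)) /u /=; case: eqP => [Ecard | _]; last first.
  by rewrite big1 // => s _; rewrite mul0r.
have in_T := crossing_types_shift ab B'j0 lt_rp Ecard.
rewrite (bigD1 _ in_T) /= eqxx big1 ?addr0 // => s /andP[_ /negPf->].
by rewrite mul0r.
Qed.

End Admissible.

(** * Periodicity *)

Lemma iter_dwork_tuple p n (a : 'I_n -> rat) m i :
  iter m (@dwork_tuple p n) a i = iter m (dwork p) (a i).
Proof. by elim: m => //= m <-. Qed.

Lemma pochhammer1 i : pochhammer 1 i = (i`!)%:R.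
Proof.
elim: i => [|i IHi]; first by rewrite pochhammer0.
by rewrite pochhammerS IHi nat1r factS natrM mulrC.
Qed.

Lemma hyp_coefE n (j0 : 'I_n) (a b : 'I_n -> rat) k : j0.+1 = n -> b j0 = 1 ->
  hyp_coef a b k = hypQ a b set0 set0 k.
Proof.
move=> Ej0 bj0; rewrite hypQ0E /hyp_coef; congr (_ / _).
rewrite [RHS](bigD1 j0) //= bj0 pochhammer1 mulrC; congr (_ * _).
apply: eq_bigl => j; rewrite -val_eqE /=.
by have := ltn_ord j; rewrite -[X in (_ < X)%N]Ej0 -[X in (_.+1 < X)%N = _]Ej0; lia.
Qed.

Section Periodic.
Variables (p d n l : nat) (j0 : 'I_n) (a b : 'I_n -> rat).
Hypotheses (p_pr : prime p) (d_gt0 : (0 < d)%N) (lt_dp : (d < p)%N).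
Hypotheses (l_gt0 : (0 < l)%N) (pl1 : (p ^ l = 1 %[mod d])%N).
Hypothesis ab : admissible p d j0 a b.

Let level m := (iter m (@dwork_tuple p n) a, iter m (@dwork_tuple p n) b).
Let types m := crossing_types p (level m).1 (level m).2.

Lemma admissible_iter m : admissible p d j0 (level m).1 (level m).2.
Proof. by elim: m => //= m; apply: admissible_dwork. Qed.

Lemma level_period m : level (l + m) = level m.
Proof.
rewrite /level; congr (_, _); apply/funext => i; rewrite !iter_dwork_tuple addnC iterD.
  by rewrite (dwork_period p_pr d_gt0 lt_dp pl1 (adm_a ab i)).
by rewrite (dwork_period p_pr d_gt0 lt_dp pl1 (adm_b ab i)).
Qed.

Lemma level_period_mul k m : level (l * k + m) = level m.
Proof.
by elim: k => [|k IHk]; rewrite ?muln0 // mulnS -addnA level_period.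
Qed.

(** The shifts at level m come from crossings at level m - 1, written m + l - 1 by periodicity so
    that m = 0 makes sense. *)
Lemma hyp_fps_level m : exists W : {set 'I_n} * {set 'I_n} -> {poly 'F_p},
  (forall t, (size (W t) <= p ^ m)%N) /\
  hyp_fps p a b (set0, set0) = \sum_(t in types (m + l.-1))
    fps_of_poly (W t) * hyp_fps p (level m).1 (level m).2 t ^+ (p ^ m).
Proof.
elim: m => [|m [W [size_W EW]]].
  exists (fun t => (t == (set0, set0))%:R); split=> [t|].
    by case: eqP; rewrite ?size_poly1 ?size_poly0.
  have in_T := crossing_types0 p_pr (level l.-1).1 (level l.-1).2.
  rewrite (bigD1 _ in_T) /= eqxx rmorph1 mul1r expr1 big1 ?addr0 //.
  by move=> t /andP[_ /negPf->]; rewrite rmorph0 mul0r.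
have /choice[P HP] : forall t, exists P : {set 'I_n} * {set 'I_n} -> {poly 'F_p},
    t \in types (m + l.-1) -> (forall s, (size (P s) <= p)%N) /\
    hyp_fps p (level m).1 (level m).2 t = \sum_(s in types m)
      fps_of_poly (P s) * hyp_fps p (level m.+1).1 (level m.+1).2 s ^+ p.
  move=> t; have [t_in | t'in] := boolP (t \in types (m + l.-1)); last by exists (fun=> 0).
  have j0'B := crossing_types_one p_pr d_gt0 lt_dp (admissible_iter _) t_in.
  by have [P ? ?] := hyp_fps_dwork p_pr d_gt0 lt_dp (admissible_iter m) j0'B; exists P.
have p_gt0 := prime_gt0 p_pr.
have pm_gt0 : (0 < p ^ m)%N by rewrite expn_gt0 p_gt0.
exists (fun s => \sum_(t in types (m + l.-1)) W t * P t s ^+ (p ^ m)); split.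
  move=> s; apply: leq_trans (size_sum _ _ _) _; apply/bigmax_leqP => t t_in.
  apply: leq_trans (size_polyMleq _ _) _.
  have [le_P _] := HP t t_in; have := le_P s; have := size_W t.
  have : (size (P t s ^+ (p ^ m)) <= (p.-1 * p ^ m).+1)%N.
    rewrite (leq_trans (leqSpred _)) // size_exp ltnS leq_mul2r.
    by rewrite -!subn1 leq_sub2r ?orbT.
  (* Degrees add up to at most (p^m - 1) + (p - 1) p^m = p^(m+1) - 1. *)
  have -> : (p ^ m.+1 = p ^ m + p.-1 * p ^ m)%N by rewrite -mulSn prednK // expnS.
  by lia.
have -> : types (m.+1 + l.-1) = types m.
  by rewrite /types addSnnS prednK // addnC level_period.
rewrite EW; under eq_bigr => t t_in.
  rewrite (HP t t_in).2 fps_Frob_sum // mulr_sumr.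
  under eq_bigr do rewrite exprMn -exprM -expnS mulrA.
  over.
rewrite exchange_big /=; apply: eq_bigr => s _.
rewrite -mulr_suml rmorph_sum; congr (_ * _); apply: eq_bigr => t _.
by rewrite rmorphM rmorphXn.
Qed.

Lemma hyp_fps_frobenius k : exists W : {set 'I_n} * {set 'I_n} -> {poly 'F_p},
  (forall t, (size (W t) <= (p ^ l) ^ k)%N) /\
  hyp_fps p a b (set0, set0) = \sum_(t in types l.-1)
    fps_of_poly (W t) * hyp_fps p a b t ^+ ((p ^ l) ^ k).
Proof.
have [W] := hyp_fps_level (l * k); rewrite -expnM.
have := level_period_mul k 0; rewrite addn0 => ->.
by rewrite /types level_period_mul; exists W.
Qed.

End Periodic.

(** * Crossing types counted by the set S *)

Section StartingPoints.
Variables (p d n : nat) (j0 : 'I_n) (a b : 'I_n -> rat).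
Hypotheses (p_pr : prime p) (d_gt0 : (0 < d)%N) (lt_dp : (d < p)%N).
Hypotheses (Ej0 : j0.+1 = n) (ab : admissible p d j0 a b).

Lemma redp_param (x : rat) : param d x -> redp p x = - (thresh p x)%:R.
Proof.
move=> x_par; have [_ Et] := threshP p_pr (param_loc p_pr d_gt0 lt_dp x_par).
apply: (reduces_redp p_pr).
have Ex : x = p%:R * dwork p x - (thresh p x)%:R by rewrite -Et subKr.
rewrite {1}Ex.
apply: (@reduces_eq _ _ (0 * redp p (dwork p x) - (thresh p x)%:R)).
  by rewrite mul0r sub0r.
apply: reducesD; last exact/reducesN/reduces_nat.
by apply: reducesM (reduces_p p_pr) (zloc_reduces p_pr _); exact: (dwork_loc p_pr d_gt0 lt_dp).
Qed.

Lemma vp_padic_unit (x : rat) : padic_unit p x -> vp p x = 0.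
Proof.
move=> x_unit; have /andP[x_loc nz_x] := x_unit.
have logn0' m : ~~ (p %| m)%N -> logn p m = 0%N.
  by move=> p'm; rewrite lognE (negPf p'm) !andbF.
move: nz_x; rewrite /redp /ratr mulf_eq0 negb_or intr_Fp_eq0 // => /andP[p'num _].
by rewrite /vp !logn0' ?subrr.
Qed.

(** Send a type to the least r that produces it. Balance makes the coefficient at r a unit. If r >
    0, some b_j has threshold r - 1, that is, r is 1 - b_j modulo p; otherwise the type would
    already occur at r - 1. *)
Lemma card_crossing_types :
  (#|crossing_types p a b| <= #|S_set p a b|)%N.
Proof.
pose h (r : 'I_p) := (crossed p a set0 r, crossed p b set0 r).
suff sub : crossing_types p a b \subset [set h r | r in S_set p a b].
  exact: leq_trans (subset_leq_card sub) (leq_imset_card _ _).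
apply/subsetP => _ /imsetP[r0 + ->]; rewrite inE => bal0.
pose pr r := (crossed p a set0 r, crossed p b set0 r).
have ex_r : exists r, (r < p)%N && (pr r == pr r0) by exists r0; rewrite ltn_ord eqxx.
have [r /andP[lt_r /eqP Er] min_r] := ex_minnP ex_r.
apply/imsetP; exists (Ordinal lt_r); last by rewrite /h /= -/(pr r) Er.
have bal : #|crossed p a set0 r| == #|crossed p b set0 r|.
  by case: Er => -> ->.
have Q_unit : padic_unit p (hyp_coef a b r).
  rewrite (hyp_coefE _ _ Ej0 (adm_one ab)).
  have [v nz_v Hv] := hypQ_dwork p_pr d_gt0 lt_dp set0 set0 (adm_a ab) (adm_b ab) (ltnW lt_r).
  have [V red_V] := Hv 0%N; rewrite muln0 add0n hypQ_at0 (eqP bal) divff; last first.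
    by rewrite expf_neq0 // pnatr_eq0 -lt0n prime_gt0.
  by rewrite !mul1r => ->; apply/(padic_unitP p_pr); exists v.
rewrite inE /= (padic_unit_neq0 p_pr Q_unit) vp_padic_unit // eqxx !andbT.
rewrite inE /=; case: r => [|r] in lt_r Er min_r bal Q_unit *; first by rewrite eqxx.
apply/orP; right.
have b_par := adm_b ab; have a_par := adm_a ab.
have [/existsP[j /eqP Ej] | /existsPn none] := boolP [exists j, thresh p (b j) == r].
  apply/existsP; exists j; apply/andP; split.
    rewrite ltn_neqAle ltn_ord andbT; apply/eqP => Ejn.
    have Ejj0 : j = j0 by apply: val_inj; move: Ejn; rewrite -[X in _ = X]Ej0 => -[].
    move: Ej; rewrite Ejj0 (adm_one ab) (thresh1 p_pr); lia.
  have red1 : reduces (p := p) (1 - b j) (1 - redp p (b j)).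
    apply: reducesD (reduces1 p) _; apply/reducesN/(zloc_reduces p_pr).
    exact: (param_loc p_pr d_gt0 lt_dp).
  by rewrite (reduces_redp p_pr red1) redp_param // Ej opprK -natr1 addrC.
have EB : crossed p b set0 r.+1 = crossed p b set0 r.
  by apply/setP => j; rewrite !inE subn0 ltnS leq_eqVlt (negPf (none j)).
(* With no new crossing in b, [card_crossed] at r allows none in a. *)
have EA : crossed p a set0 r.+1 = crossed p a set0 r.
  apply/esym/eqP; rewrite eqEcard (eqP bal) EB.
  rewrite (card_crossed p_pr d_gt0 lt_dp _ _ ab) ?andbT; last lia.
  by apply/subsetP => i; rewrite !inE; lia.
have : (r.+1 <= r)%N.
  by apply: min_r; rewrite (ltnW lt_r) -Er /pr EA EB eqxx.
by rewrite ltnn.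
Qed.

Lemma card_S_set : (#|S_set p a b| <= n)%N.
Proof.
(* The index j0 stands for the residue 0. *)
pose h (j : 'I_n) : 'I_p := cast_ord (Fp_cast p_pr) (if j == j0 then 0 else redp p (1 - b j)).
have sub : S_set p a b \subset [set h j | j in 'I_n].
  have castP (r : 'I_p) (y : 'F_p) : (r : nat)%:R = y -> r = cast_ord (Fp_cast p_pr) y.
    by move=> <-; apply: val_inj; rewrite /= val_Fp_nat // modn_small.
  apply/subsetP => r; rewrite inE => /andP[+ _]; rewrite inE.
  case/orP => [/eqP r0 | /existsP[j /andP[lt_j /eqP Er]]].
    by apply/imsetP; exists j0; rewrite // /h eqxx; exact: castP.
  apply/imsetP; exists j => //; rewrite /h; case: eqP => [Ej|_]; last exact: castP.
  by move: lt_j; rewrite Ej [X in (X < _)%N]Ej0 ltnn.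
apply: leq_trans (subset_leq_card sub) _; apply: leq_trans (leq_imset_card _ _) _.
by rewrite card_ord.
Qed.

End StartingPoints.

(** * The additive polynomial annihilating f *)

Lemma dvdn_biglcm (I : finType) (P : pred I) (F : I -> nat) i : P i ->
  (F i %| \big[lcmn/1%N]_(j | P j) F j)%N.
Proof. by move=> Pi; rewrite (bigD1 i) //= dvdn_lcml. Qed.

Lemma common_den_gt0 n (a b : 'I_n -> rat) : (0 < common_den a b)%N.
Proof.
have pos (P : pred 'I_n) (F : 'I_n -> nat) : (forall i, 0 < F i)%N ->
    (0 < \big[lcmn/1%N]_(j | P j) F j)%N.
  by move=> F_gt0; elim/big_ind: _ => // x y; rewrite lcmn_gt0 => -> ->.
by rewrite lcmn_gt0 !pos // => i; rewrite absz_gt0 denq_eq0.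
Qed.

Lemma natmul_int (x : rat) d : (`|denq x| %| d)%N -> d%:R * x \is a Num.int.
Proof.
move=> /dvdnP[c ->]; rewrite natrM -mulrA natr_absz normr_denq.
by rewrite [_ * x]mulrC -numqE rpredM ?intr_int // natr_int.
Qed.

Lemma mod_order_dvdn d p : (1 < d)%N -> coprime d p ->
  [/\ (0 < mod_order d p)%N, (p ^ mod_order d p = 1 %[mod d])%N &
      (mod_order d p <= totient d)%N].
Proof.
move=> d_gt1 co_dp; split; first exact: order_gt0.
  by apply/eqP; rewrite -mod_orderP.
apply: dvdn_leq; first by rewrite totient_gt0 ltnW.
by rewrite mod_orderP // Euler_exp_totient // coprime_sym.
Qed.

Section Main.
Variables (n : nat) (alpha beta : 'I_n -> rat) (p : nat).
Hypotheses (n_gt0 : (0 < n)%N)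
  (alpha_01 : forall i, 0 < alpha i <= 1)
  (beta_01 : forall j, 0 < beta j <= 1)
  (beta_last : forall j : 'I_n, j.+1 = n -> beta j = 1)
  (p_prime : prime p)
  (p_gt : (2 * common_den alpha beta < p)%N)
  (f_zloc : forall i, zloc p (fcoef (hypergeometric alpha beta) i))
  (alpha_beta : forall i j, alpha i - beta j \isn't a Num.int).

Let d := common_den alpha beta.
Let l := mod_order d p.
Let q := (p ^ l)%N.
Let S := S_set p (iter l.-1 (@dwork_tuple p n) alpha)
                 (iter l.-1 (@dwork_tuple p n) beta).

Lemma last_index : exists j0 : 'I_n, j0.+1 = n.
Proof. by case: n n_gt0 => // m _; exists ord_max. Qed.

Let d_gt0 : (0 < d)%N. Proof. exact: common_den_gt0. Qed.
Let lt_dp : (d < p)%N. Proof. by have := p_gt; rewrite -/d; lia. Qed.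

Lemma param_alpha i : param d (alpha i).
Proof.
rewrite /param alpha_01 /=; apply/natmul_int/dvdn_trans/dvdn_lcml.
exact: (@dvdn_biglcm _ xpredT).
Qed.

Lemma param_beta j : param d (beta j).
Proof.
rewrite /param beta_01 /=; have [Ej | ne_j] := eqVneq j.+1 n.
  by rewrite (beta_last Ej) mulr1 natr_int.
apply/natmul_int/dvdn_trans/dvdn_lcmr.
by apply: (@dvdn_biglcm _ (fun j : 'I_n => j.+1 < n)%N); rewrite ltn_neqAle ne_j ltn_ord.
Qed.

(** If d = 1, alpha_n would be an integer and differ from beta_n = 1 by an integer. The order of p
    modulo d is meaningful for d > 1. *)
Lemma common_den_gt1 : (1 < d)%N.
Proof.
rewrite ltn_neqAle d_gt0 andbT; apply/eqP => d1.
have [j0 Ej0] := last_index.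
have /andP[_] := param_alpha j0; rewrite -d1 mul1r => a_int.
by have /negP[] := alpha_beta j0 j0; rewrite (beta_last Ej0) rpredB.
Qed.

Lemma mod_order_props :
  [/\ (0 < l)%N, (p ^ l = 1 %[mod d])%N & (l <= totient d)%N].
Proof.
apply: mod_order_dvdn; first exact: common_den_gt1.
by rewrite coprime_sym prime_coprime // gtnNdvd.
Qed.

Lemma admissible_alpha_beta (j0 : 'I_n) : j0.+1 = n -> admissible p d j0 alpha beta.
Proof.
move=> Ej0; split; [exact: param_alpha | exact: param_beta | | exact: beta_last |].
  by move=> i j; apply: contraNneq (alpha_beta i j) => ->; rewrite subrr rpred0.
by move=> k; rewrite -(hyp_coefE _ _ Ej0 (beta_last Ej0)); exact: f_zloc.
Qed.

Lemma card_S : (0 < #|S| <= n)%N.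
Proof.
have [j0 Ej0] := last_index; have ab := admissible_alpha_beta Ej0.
have abl := admissible_iter p_prime d_gt0 lt_dp ab l.-1.
rewrite (card_S_set _ _ p_prime Ej0) andbT.
apply: leq_trans (card_crossing_types p_prime d_gt0 lt_dp Ej0 abl).
by apply/card_gt0P; exists (set0, set0); exact: crossing_types0.
Qed.

Lemma frobenius_polynomial : exists Q : nat -> {fraction {poly 'F_p}},
  let P := 'X - \sum_(1 <= i < #|S|.+1) Q i *: 'X^(q ^ i) in
  [/\ forall i, (#|S| < i)%N -> Q i = 0,
      (poly_height P <= #|S| * (q ^ #|S|).-1)%N,
      eval_fps P (fps_map (@redp p) (hypergeometric alpha beta)) = 0 &
      #|S| = 1%N -> exists2 Q1 : {poly 'F_p}, (size Q1 <= q)%N & Q 1%N = Q1%:F].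
Proof.
have [j0 Ej0] := last_index; have ab := admissible_alpha_beta Ej0.
have [l_gt0 pl1 _] := mod_order_props.
have abl := admissible_iter p_prime d_gt0 lt_dp ab l.-1.
have q_gt1 : (1 < q)%N by rewrite -(exp1n l) ltn_exp2r // prime_gt1.
set f := fps_map _ _.
have Ef : f = hyp_fps p alpha beta (set0, set0).
  by apply: fpsP => k /=; rewrite (hyp_coefE _ _ Ej0 (beta_last Ej0)).
have leTS := card_crossing_types p_prime d_gt0 lt_dp Ej0 abl; rewrite -/S in leTS.
have frob := hyp_fps_frobenius p_prime d_gt0 lt_dp l_gt0 pl1 ab.
(* The general relation would only give a fraction Q_1. When #S = 1 the sole type is the pair of
   empty sets, and f = W f^q with W a polynomial. *)
have [S1 | ne_S1] := eqVneq #|S| 1%N.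
  have ET : crossing_types p (iter l.-1 (@dwork_tuple p n) alpha)
      (iter l.-1 (@dwork_tuple p n) beta) = [set (set0, set0)].
    apply/esym/eqP; rewrite eqEcard sub1set cards1 -S1 leTS andbT.
    exact: crossing_types0.
  have [W [size_W EW]] := frob 1%N; rewrite expn1 in size_W EW.
  move: EW; rewrite ET big_set1 -Ef => EW.
  exists (fun i => if i == 1%N then (W (set0, set0))%:F else 0) => P; split.
  - by move=> i; rewrite S1; case: eqP => // ->.
  - apply: poly_height_additive => // i; case: eqP => _; last by rewrite oppr0 height0.
    rewrite -tofracN -[_%:F]divr1 -tofrac1 height_div_le ?oner_eq0 ?size_poly1 //.
    by rewrite size_polyN S1 mul1n expn1 prednK // ltnW.
  - rewrite eval_additive_poly // S1 big_nat1 expn1.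
    by rewrite laurent_of_poly -tofracM -EW subrr.
  by move=> _; exists (W (set0, set0)).
have [c [nz_c size_c rel_c]] :=
  frobenius_relation p_prime l_gt0 leTS (fun k => frob k).
have [Q [Q0 hQ evQ]] := additive_poly_of_relation q_gt1 nz_c size_c rel_c.
exists Q => P; split=> //; first by rewrite Ef.
by move=> S1; rewrite S1 eqxx in ne_S1.
Qed.

End Main.

Theorem theorem1p3 (n : nat) (alpha beta : 'I_n -> rat) (p : nat)
  (n_gt0 : (0 < n)%N)
  (alpha_01 : forall i, 0 < alpha i <= 1)
  (beta_01 : forall j, 0 < beta j <= 1)
  (beta_last : forall j : 'I_n, j.+1 = n -> beta j = 1)
  (p_prime : prime p)
  (p_gt : (2 * common_den alpha beta < p)%N)
  (f_zloc : forall i, zloc p (fcoef (hypergeometric alpha beta) i))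
  (alpha_beta : forall i j, alpha i - beta j \isn't a Num.int) :
  let d := common_den alpha beta in
  let f := hypergeometric alpha beta in
  let N := (p ^ (2 ^ n * totient d))%N in
  let l := mod_order d p in
  let S := S_set p (iter l.-1 (@dwork_tuple p n) alpha)
                   (iter l.-1 (@dwork_tuple p n) beta) in
  exists P : {poly {fraction {poly 'F_p}}},
    P != 0 /\
    ((size P).-1 <= N)%N /\
    (poly_height P <= 5 ^ n * (n.+1)`! * N)%N /\
    eval_fps P (fps_map (@redp p) f) = 0 /\
    (#|S| = 1%N ->
       exists Q1 : {poly 'F_p},
         (size Q1 <= p ^ l)%N /\
         P = 'X - Q1%:F *: 'X^(p ^ l)) /\
    (#|S| = 2%N ->
       (exists Q1 Q2 : {fraction {poly 'F_p}},
          P = 'X - Q1 *: 'X^(p ^ l) - Q2 *: 'X^(p ^ (2 * l))) /\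
       (poly_height P < 2 * p ^ (2 * l))%N) /\
    (forall t : nat, #|S| = t.+1 -> (2 < t.+1)%N ->
       (exists Q : nat -> {fraction {poly 'F_p}},
          P = 'X - \sum_(1 <= i < (2 ^ t).+1) Q i *: 'X^(p ^ (i * l))) /\
       (poly_height P < 5 ^ t * (t.+1)`! * p ^ (2 ^ t * l))%N).
Proof.
move=> d f N l S.
have [l_gt0 _ le_l] :=
  mod_order_props n_gt0 alpha_01 beta_last p_prime p_gt alpha_beta.
have /andP[S_gt0 S_le] :=
  card_S n_gt0 alpha_01 beta_01 beta_last p_prime p_gt f_zloc alpha_beta.
have [Q] :=
  frobenius_polynomial n_gt0 alpha_01 beta_01 beta_last p_prime p_gt f_zloc alpha_beta.
rewrite -/d -/f -/l -/S in l_gt0 le_l S_gt0 S_le *.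
set P := _ - _; move=> [Q0 hP evP S1].
have p_gt0 := prime_gt0 p_prime; have p_gt1 := prime_gt1 p_prime.
have q_gt1 : (1 < p ^ l)%N by rewrite -(exp1n l) ltn_exp2r.
have lt_2n m : (m < 2 ^ m)%N by exact: ltn_expl.
(* This combines #S <= n < 2^n with l <= phi(d). *)
have qS_le : ((p ^ l) ^ #|S| <= N)%N.
  rewrite -expnM leq_exp2l // mulnC leq_mul //.
  exact: leq_trans S_le (ltnW (lt_2n n)).
have qE i : ((p ^ l) ^ i = p ^ (i * l))%N by rewrite -expnM mulnC.
exists P; split; first exact: additive_poly_neq0.
split; first by apply: leq_trans qS_le; exact: size_additive_poly.
split.
  apply: leq_trans hP _; apply: leq_mul; last exact: leq_trans (leq_pred _) qS_le.
  apply: leq_trans (leq_trans (leqW S_le) (fact_geq _)) _.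
  by rewrite leq_pmull // expn_gt0.
split=> //; split=> [Scard|].
  by have [Q1 size_Q1 EQ1] := S1 Scard; exists Q1; rewrite /P Scard big_nat1 expn1 EQ1.
split=> [Scard|t Scard t_gt1].
  split.
    exists (Q 1%N), (Q 2%N).
    by rewrite /P Scard big_nat_recr //= big_nat1 !qE mul1n opprD addrA.
  apply: leq_ltn_trans hP _; rewrite Scard qE ltn_mul2l /= ltn_predL expn_gt0.
  by rewrite p_gt0.
have lt_t : (t.+1 <= 2 ^ t)%N by [].
split.
  (* The terms beyond t + 1, up to 2^t, are padded with zeros. *)
  exists Q; congr (_ - _).
  rewrite [RHS](big_cat_nat (n := t.+2)) //= Scard [X in _ + X]big_nat.
  rewrite [X in _ + X]big1 ?addr0 => [|i /andP[lt_i _]].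
    by apply: eq_bigr => i _; rewrite qE.
  by rewrite Q0 ?scale0r // Scard.
apply: leq_ltn_trans hP _; rewrite Scard.
have lt1 : (t.+1 * ((p ^ l) ^ t.+1).-1 < t.+1 * (p ^ l) ^ t.+1)%N.
  by rewrite ltn_mul2l /= ltn_predL expn_gt0 ltnW.
apply: leq_trans lt1 _; apply: leq_mul.
  by apply: leq_trans (fact_geq _) _; rewrite leq_pmull // expn_gt0.
by rewrite qE leq_exp2l // leq_mul2r lt_t orbT.
Qed.
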